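(* The function $\rho$ attains its global minimum on $(0,\infty)$. Set $\alpha_*=-\min_{u>0}\rho(u)$. Then $$-\frac12<\alpha_*<\alpha_0,$$ where $\alpha_0=-\frac12+\frac{e^{-\gamma-1}}{12}$, and for every $\alpha\in\mathbb{R}$, $$f_\alpha\text{ is logarithmically completely monotone on }(0,\infty)\quad\Longleftrightarrow\quad\alpha\ge\alpha_*.$$ For every admissible parameter (that is, every $\alpha\ge\alpha_*$), including $\alpha=\alpha_*$, the logarithmic complete monotonicity of $f_\alpha$ is strict.
   Context: Let $\psi=\Gamma'/\Gamma$ be the digamma function and $\gamma=-\psi(1)$ the Euler–Mascheroni constant. For $t>0$ and $\alpha\in\mathbb{R}$ put $$\Theta(t)=t\bigl(\log t-\psi(t)\bigr),\qquad f_\alpha(t)=\exp\bigl(-[\Theta(t)+\alpha]\log t\bigr).$$ For $u>0$ define $$h(u)=\frac1{u^2}-\frac1{4\sinh^2(u/2)},\qquad J(u)=u\int_0^u\frac{h(v)-h(u)}{u-v}\,dv,$$ $$\rho(u)=\frac12+uh(u)(\gamma+\log u)+J(u),$$ where the integral in $J$ is an ordinary convergent integral, its integrand being extended continuously at $v=u$ (the function $h$ extends smoothly to $0$ with $h(0)=1/12$). A positive function $f\in C^\infty(0,\infty)$ is called logarithmically completely monotone on $(0,\infty)$ if $(-1)^m(\log f)^{(m)}(t)\ge0$ for all $t>0$ and all integers $m\ge1$; the property is called strict if all these inequalities are strict. *)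

(* Defs.v *)
From HB Require Import structures.
From mathcomp Require Export all_boot all_order all_algebra.
From mathcomp Require Export all_classical all_reals all_analysis.
Import Order.TTheory GRing.Theory Num.Theory.
Import numFieldNormedType.Exports.

Set Implicit Arguments.
Unset Strict Implicit.
Unset Printing Implicit Defensive.

Local Open Scope ring_scope.
Local Open Scope classical_set_scope.

Section Definitions.
Context {R : realType}.
Implicit Types (f : R -> R) (a t u v : R).

Definition Gamma t : R :=
  (\int[@lebesgue_measure R]_(x in `]0%R, +oo[) (x `^ (t - 1) * expR (- x)))%R.

Definition digamma t : R := Gamma^`()%classic t / Gamma t.

Definition euler_gamma : R := - digamma 1.

Definition Theta t : R := t * (ln t - digamma t).

Definition f_ a t : R := expR (- (Theta t + a) * ln t).

Definition sinh u : R := (expR u - expR (- u)) / 2.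

(* The closed formula is meant for u > 0; the value at 0 is its limit. *)
Definition h u : R :=
  if u == 0 then 12^-1 else 1 / u ^+ 2 - 1 / (4 * sinh (u / 2) ^+ 2).

(* The integrand of J, with its limit - h'(u) as value on the diagonal. *)
Definition J_integrand u v : R :=
  if v == u then - h^`()%classic u else (h v - h u) / (u - v).

Definition J u : R :=
  (u * \int[@lebesgue_measure R]_(v in `[0%R, u]) J_integrand u v)%R.

Definition rho u : R := 1 / 2 + u * h u * (euler_gamma + ln u) + J u.

Definition alpha0 : R := - (1 / 2) + expR (- euler_gamma - 1) / 12.

Definition smooth_pos f := forall (n : nat) t, 0 < t -> derivable (f^`(n)%classic) t 1.

Definition log_completely_monotone f :=
  [/\ forall t, 0 < t -> 0 < f t,
      smooth_pos f &
      forall (m : nat) t, (1 <= m)%N -> 0 < t ->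
        0 <= (-1) ^+ m * (@ln R \o f)^`(m)%classic t].

Definition strictly_log_completely_monotone f :=
  [/\ forall t, 0 < t -> 0 < f t,
      smooth_pos f &
      forall (m : nat) t, (1 <= m)%N -> 0 < t ->
        0 < (-1) ^+ m * (@ln R \o f)^`(m)%classic t].

Definition global_min_pos f u0 :=
  0 < u0 /\ forall u, 0 < u -> f u0 <= f u.

End Definitions.

(* Main.v *)
Require Import Defs.
From mathcomp Require Import measurable_realfun.
From mathcomp Require Import ring lra.
Import Order.TTheory GRing.Theory Num.Theory.
Import numFieldNormedType.Exports.

(* Let L be the Laplace transform and phi(u) = 1/(1 - e^-u) - 1/u. Then
   psi(t) = ln t - L[phi](t): both sides satisfy F(t + 1) = F(t) + 1/t and
   differ from ln t by a quantity vanishing at infinity. As phi(0+) = 1/2 and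
   phi' = h, an integration by parts turns this into Theta = 1/2 + L[h], so
   - ln f_alpha(t) = (alpha + 1/2 + L[h](t)) ln t. Expressing ln t L[uh](t)
   through L[ln](t) = - (gamma + ln t)/t and exchanging integrals, the
   derivative of - ln f_alpha is L[alpha + rho], hence
     (-1)^m (ln f_alpha)^(m) (t) = L[u^(m-1) (alpha + rho)](t).
   Thus alpha + rho >= 0 is sufficient, strictly because rho is not constant,
   and it is necessary by Laplace's method: as n grows, u^n e^(-nu/u0)
   concentrates at u0.
   Finally, h decreases (Lazarevic's inequality), so J >= 0. Hence
   rho >= 1/2 for u >= e^-gamma, and below e^-gamma
   rho > 1/2 + (u/12)(gamma + ln u) >= 1/2 - e^(-gamma-1)/12. As rho(0+) = 1/2
   while rho < 1/2 near 0, the minimum is attained. *)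

Set Implicit Arguments.
Unset Strict Implicit.
Unset Printing Implicit Defensive.

Local Open Scope ring_scope.
Local Open Scope classical_set_scope.

(** The delicate object is the divided difference inside [J]. With s = u - v its kernel is (h(u - s)
    - h(u)) / s, and near s = 0 the two halves cannot be integrated separately. Translating u by s
    in the half that contains h(u - s) turns the pair into the compensated kernel (e^(-ts) - 1_{s <
    u}) / s, which is integrable in s with integral -(gamma + ln t + ln u). This is the origin of
    the factor gamma + ln u in [rho]: that term cancels the ln u part and leaves ln t L[uh](t),
    which is what differentiating (1/2 + L[h](t)) ln t produces. The first exchange of integrals
    converges absolutely because [h] is Lipschitz up to 0; the constant 16 is crude but explicit,
    and it reappears in J <= 16 u^2. The estimates on [rho] use of [h] only that it decreases, lies
    between 0 and 1/12, is at least 1/24 near 0 and is 16-Lipschitz. Integrals over moving domains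
    are rewritten over the fixed half-line with indicator factors, so that Fubini, translation and
    dominated convergence all act on one domain. *)

Section Measurability.
Context d {T : measurableType d} {R : realType}.

Lemma measurable_funV (D : set T) (f : T -> R) :
  measurable_fun D f -> measurable_fun D (fun x => (f x)^-1).
Proof.
move=> mf.
(* Squaring makes the base nonnegative, where [powR] with exponent -1 is the inverse; at 0 both
   sides vanish. *)
have -> : (fun x => (f x)^-1) = (fun x => f x * ((f x ^+ 2) `^ (-1))).
  apply/funext => x; rewrite powR_inv1 ?sqr_ge0// expr2.
  have [->|fx0] := eqVneq (f x) 0; first by rewrite invr0 mul0r.
  by rewrite invfM mulrA divff// mul1r.
apply: measurable_funM => //.
apply: (measurableT_comp (f := fun y => y `^ (-1))); first exact: measurable_powR.
exact: measurable_funX.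
Qed.

Lemma measurable_fun_div (D : set T) (f g : T -> R) :
  measurable_fun D f -> measurable_fun D g -> measurable_fun D (fun x => f x / g x).
Proof. by move=> mf mg; apply: measurable_funM => //; exact: measurable_funV. Qed.

Lemma measurable_fun_expR (D : set T) (f : T -> R) :
  measurable_fun D f -> measurable_fun D (fun x => expR (f x)).
Proof. by move=> mf; exact: measurableT_comp. Qed.

Lemma measurable_fun_ln (D : set T) (f : T -> R) :
  measurable_fun D f -> measurable_fun D (fun x => ln (f x)).
Proof. by move=> mf; apply: measurableT_comp => //; exact: measurable_ln. Qed.

Lemma measurable_fun_ltrb (f g : T -> R) :
  measurable_fun setT f -> measurable_fun setT g ->
  measurable_fun setT (fun x => ((f x < g x)%R)%:R : R).
Proof.
move=> mf mg.
have -> : (fun x => ((f x < g x)%R)%:R : R) = (fun x => if (f x < g x)%R then 1 else 0).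
  by apply/funext => x; case: ifP.
by apply: measurable_fun_ifT => //; exact: measurable_fun_ltr.
Qed.

End Measurability.

(** * Lebesgue measure under affine maps *)

Section AffineChange.
Context {R : realType}.
Local Notation mu := (@lebesgue_measure R).
Local Open Scope ereal_scope.

Let aff (a b : R) : measurableTypeR R -> measurableTypeR R := fun x => (a * x + b)%R.

Let measurable_aff a b : measurable_fun setT (aff a b).
Proof. by apply: measurable_funD => //; exact: measurable_funM. Qed.

(** The right-hand side is itself a measure in [A], so uniqueness of Lebesgue measure leaves only
    half-open intervals to check. A negative slope swaps the closed end, hence the two cases. *)
Lemma lebesgue_measure_affine (a b : R) (A : set R) : (a != 0)%R -> measurable A ->
  mu A = `|a|%:E * mu ((fun x => a * x + b)%R @^-1` A).
Proof.
move=> a0 mA.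
apply: (lebesgue_measure_unique (mu := mscale (NngNum (normr_ge0 a)) (pushforward mu (aff a b)))) => //= _ [[c e]] _ <-.

rewrite /mscale/= /pushforward /aff.
have [an|ap|a00] := ltgtP a 0%R; last by rewrite a00 eqxx in a0.
- rewrite [X in _ * mu X](_ : _ = `[((e - b) / a)%R, ((c - b) / a)%R[%classic); last first.
    apply/seteqP; split => x /=; rewrite !in_itv/= ler_ndivrMr// ltr_ndivlMr// [(x * a)%R]mulrC => /andP[? ?]; apply/andP; split; lra.
  rewrite !lebesgue_measure_itv/= !lte_fin ltr_ndivrMr// divfK// ltrD2r.
  by case: ifPn => _; rewrite ?mule0// -EFinB -EFinM ltr0_norm//; congr EFin; field.
- rewrite [X in _ * mu X](_ : _ = `]((c - b) / a)%R, ((e - b) / a)%R]%classic); last first.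
    apply/seteqP; split => x /=; rewrite !in_itv/= ler_pdivlMr// ltr_pdivrMr// [(x * a)%R]mulrC => /andP[? ?]; apply/andP; split; lra.
  rewrite !lebesgue_measure_itv/= !lte_fin ltr_pdivrMr// divfK// ltrD2r.
  by case: ifPn => _; rewrite ?mule0// -EFinB -EFinM gtr0_norm//; congr EFin; field.
Qed.

Lemma ge0_integral_affine (a b : R) (f : R -> \bar R) : (a != 0)%R ->
  measurable_fun setT f -> (forall x, 0 <= f x) ->
  \int[mu]_x f x = `|a|%:E * \int[mu]_x f (a * x + b)%R.
Proof.
move=> a0 mf f0.
have := ge0_integral_pushforward (measurable_aff a b) mu measurableT mf (fun y _ => f0 y).
rewrite preimage_setT /= => <-.
rewrite -(ge0_integral_mscale _ _ (NngNum (normr_ge0 a)))//.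
by apply: eq_measure_integral => A mA _; exact: lebesgue_measure_affine.
Qed.

End AffineChange.

(** * Real-valued integrals over the open half-line *)

Section HalfLine.
Context {R : realType}.
Local Notation mu := (@lebesgue_measure R).
Implicit Types (f g : R -> R).

Definition pintegrable f := mu.-integrable `]0%R, +oo[ (EFin \o f).

Definition pint f : R := \int[mu]_(x in `]0%R, +oo[) f x.

Let P : set R := `]0, +oo[.
Let mP : measurable P. Proof. exact: measurable_itv. Qed.
Let PE x : P x <-> 0 < x. Proof. by rewrite /P/= in_itv/= andbT. Qed.

Lemma pintegrable_measurable f : pintegrable f -> measurable_fun P f.
Proof. by move=> /(measurable_int mu)/measurable_EFinP. Qed.

Lemma pintegrable_le g f : measurable_fun P f -> pintegrable g ->
  (forall x, 0 < x -> `|f x| <= g x) -> pintegrable f.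
Proof.
move=> mf ig fg; apply: (le_integrable _ _ _ ig) => //; first exact/measurable_EFinP.
move=> x /PE x0 /=; rewrite lee_fin (le_trans (fg _ x0))//; exact: ler_norm.
Qed.

Lemma eq_pintegrable g f : (forall x, 0 < x -> f x = g x) ->
  pintegrable g -> pintegrable f.
Proof.
move=> fg; apply: eq_integrable => // x /[!inE] /PE x0 /=; by rewrite fg.
Qed.

Lemma eq_pint g f : (forall x, 0 < x -> f x = g x) -> pint f = pint g.
Proof. by move=> fg; apply: eq_Rintegral => x /[!inE] /PE /fg. Qed.

Lemma pintegrableD f g : pintegrable f -> pintegrable g ->
  pintegrable (fun x => f x + g x).
Proof. by move=> ? ?; exact: (@integrableD _ _ _ mu P mP (EFin \o f) (EFin \o g)). Qed.

Lemma pintegrableZ c f : pintegrable f -> pintegrable (fun x => c * f x).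
Proof. by move=> ?; exact: (@integrableZl _ _ _ mu P mP c (EFin \o f)). Qed.

Lemma pintegrableB f g : pintegrable f -> pintegrable g ->
  pintegrable (fun x => f x - g x).
Proof. by move=> ? ?; exact: (@integrableB _ _ _ mu P mP (EFin \o f) (EFin \o g)). Qed.

Lemma pintegrableN f : pintegrable f -> pintegrable (fun x => - f x).
Proof. by move=> ?; exact: (@integrableN _ _ _ mu P (EFin \o f)). Qed.

Lemma pintegrable_norm f : pintegrable f -> pintegrable (fun x => `|f x|).
Proof. exact: integrable_norm. Qed.

Lemma pintD f g : pintegrable f -> pintegrable g ->
  pint (fun x => f x + g x) = pint f + pint g.
Proof. exact: RintegralD. Qed.

Lemma pintB f g : pintegrable f -> pintegrable g ->
  pint (fun x => f x - g x) = pint f - pint g.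
Proof. exact: RintegralB. Qed.

Lemma pintZ c f : pintegrable f -> pint (fun x => c * f x) = c * pint f.
Proof. exact: RintegralZl. Qed.

Lemma pintN f : pintegrable f -> pint (fun x => - f x) = - pint f.
Proof. by move=> fi; rewrite -mulN1r -pintZ//; apply: eq_pint => x _; rewrite mulN1r. Qed.

Lemma pint_ge0 f : (forall x, 0 < x -> 0 <= f x) -> 0 <= pint f.
Proof. by move=> f0; apply: Rintegral_ge0 => x /PE /f0. Qed.

Lemma le_pint f g : pintegrable f -> pintegrable g ->
  (forall x, 0 < x -> f x <= g x) -> pint f <= pint g.
Proof. by move=> fi gi fg; apply: le_Rintegral => // x /PE /fg. Qed.

Lemma EFin_pint f : pintegrable f ->
  (pint f)%:E = (\int[mu]_(x in P) (f x)%:E)%E.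
Proof. by move=> fi; rewrite fineK//; exact: integrable_fin_num. Qed.

Lemma restrict_pos f : f \_ P = fun x => ((0 < x)%R)%:R * f x.
Proof.
apply/funext => x; rewrite patchE; case: ifPn.
  by rewrite inE => /PE ->; rewrite mul1r.
by rewrite notin_setE/= => /PE/negP; case: (0 < x)%R; rewrite ?mul0r.
Qed.

Lemma pintegrable_setT f : pintegrable f <->
  mu.-integrable setT (EFin \o (fun x => ((0 < x)%R)%:R * f x)).
Proof. by rewrite -restrict_pos -restrict_EFin; apply: integrable_mkcond. Qed.

Lemma pint_setT f : pint f = \int[mu]_x (((0 < x)%R)%:R * f x).
Proof. by rewrite /pint Rintegral_mkcond restrict_pos. Qed.

Lemma integrable_affine (a b : R) f : a != 0 -> mu.-integrable setT (EFin \o f) ->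
  mu.-integrable setT (EFin \o (fun x => f (a * x + b))).
Proof.
move=> a0 /integrableP[/measurable_EFinP mf fi].
apply/integrableP; split.
  apply/measurable_EFinP; apply: measurableT_comp => //.
  by apply: measurable_funD => //; exact: measurable_funM.
have := @ge0_integral_affine _ a b (fun x => `|(f x)%:E|%E) a0.
rewrite /= => H; move: fi; rewrite /= H//; last first.
  by apply/measurable_EFinP; exact: measurableT_comp.
by rewrite -lte_pdivlMl ?normr_gt0// mulry gtr0_sg ?mul1e// invr_gt0 normr_gt0.
Qed.

Lemma Rintegral_affine (a b : R) f : a != 0 -> mu.-integrable setT (EFin \o f) ->
  \int[mu]_x f x = `|a| * \int[mu]_x f (a * x + b).
Proof.
move=> a0 fi; have gi := integrable_affine b a0 fi.
have mf : measurable_fun setT f by move/(measurable_int mu)/measurable_EFinP : fi.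
apply/EFin_inj; rewrite EFinM /Rintegral !fineK ?integrable_fin_num//.
rewrite integralE [in RHS]integralE muleBr//.
  have H := @ge0_integral_affine _ a b _ a0.
  congr (_ - _)%E.
    rewrite H //; last exact/measurable_funepos/measurable_EFinP.
    by congr (_ * _)%E; apply: eq_integral => x _; rewrite !funeposE.
  rewrite H //; last exact/measurable_funeneg/measurable_EFinP.
  by congr (_ * _)%E; apply: eq_integral => x _; rewrite !funenegE.
apply: fin_num_adde_defl; rewrite fin_numN; exact: integrable_neg_fin_num.
Qed.

End HalfLine.

(** * Translation and dilation on the half-line *)

Section HalfLineChange.
Context {R : realType}.
Implicit Types (f g : R -> R).

Let mP : measurable (`]0, +oo[ : set R). Proof. exact: measurable_itv. Qed.

Lemma pintegrable_shift s f : 0 <= s -> pintegrable f ->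
  pintegrable (fun x => ((s < x)%R)%:R * f (x - s)).
Proof.
move=> s0 /pintegrable_setT /(integrable_affine (- s) (oner_neq0 _)) fi.
apply/pintegrable_setT; apply: eq_integrable fi => //= x _; congr EFin.
rewrite /= mul1r subr_gt0; have [sx|//] := ltP s x; last by rewrite mul0r !mulr0.
by rewrite (le_lt_trans s0 sx) !mul1r.
Qed.

Lemma pint_shift s f : 0 <= s -> pintegrable f ->
  pint (fun x => ((s < x)%R)%:R * f (x - s)) = pint f.
Proof.
move=> s0 /pintegrable_setT fi.
rewrite [RHS]pint_setT (Rintegral_affine (- s) (oner_neq0 _) fi) normr1 mul1r.
rewrite pint_setT; apply: eq_Rintegral => x _.
rewrite mul1r subr_gt0; have [sx|//] := ltP s x; last by rewrite !mul0r mulr0.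
by rewrite (le_lt_trans s0 sx) !mul1r.
Qed.

Lemma pintegrable_scale c f : 0 < c -> pintegrable f -> pintegrable (fun x => f (c * x)).
Proof.
move=> c0 /pintegrable_setT /(integrable_affine 0 (lt0r_neq0 c0)) fi.
apply/pintegrable_setT; apply: eq_integrable fi => //= x _; congr EFin.
by rewrite /= addr0 pmulr_rgt0.
Qed.

Lemma pint_scale c f : 0 < c -> pintegrable f -> pint f = c * pint (fun x => f (c * x)).
Proof.
move=> c0 /pintegrable_setT fi.
rewrite pint_setT (Rintegral_affine 0 (lt0r_neq0 c0) fi) gtr0_norm// pint_setT.
by congr (_ * _); apply: eq_Rintegral => x _; rewrite addr0 pmulr_rgt0.
Qed.

End HalfLineChange.

(** * Exchange of iterated integrals on the half-line *)

Section Fubini.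
Context {R : realType}.
Local Notation mu := (@lebesgue_measure R).

(** Stated for repeated use with a majorant [G] that needs only slice-wise and iterated
    integrability, not joint measurability. The last hypothesis gives integrability of the slices in
    x for every y, where Fubini alone gives it almost everywhere; it lets every inner integral be
    read as a real number. *)
Lemma pint_fubini (F G : R -> R -> R) :
  measurable_fun setT (fun z : R * R => F z.1 z.2) ->
  (forall x y : R, 0 < x -> 0 < y -> `|F x y| <= G x y) ->
  (forall x : R, 0 < x -> pintegrable (G x)) ->
  pintegrable (fun x => pint (G x)) ->
  (forall y : R, 0 < y -> pintegrable (F ^~ y)) ->
  pint (fun x => pint (F x)) = pint (fun y => pint (F ^~ y)) /\
  pintegrable (fun y => pint (F ^~ y)).
Proof.
move=> mF FG iG iiG iF.
have iFx x : 0 < x -> pintegrable (F x).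
  move=> x0; apply: (@pintegrable_le _ (G x)); [|exact: iG|by move=> y; exact: FG].
  by apply: measurable_funTS; exact: (measurableT_comp mF (pair1_measurable x)).
(* Extension by zero to the whole plane, where Fubini's theorem for the product measure applies. *)
pose Fb (z : R * R) : \bar R := (((0 < z.1)%R)%:R * (((0 < z.2)%R)%:R * F z.1 z.2))%:E.
have mFb : measurable_fun setT Fb.
  apply/measurable_EFinP; apply: measurable_funM.
    by apply: measurable_fun_ltrb => //; exact: measurable_fst.
  by apply: measurable_funM => //; apply: measurable_fun_ltrb => //; exact: measurable_snd.
have Fb1 x : (\int[mu]_y Fb (x, y))%E = (((0 < x)%R)%:R * pint (F x))%:E.
  rewrite /Fb/=; have [x0|x0] := ltP 0 x; last first.
    by rewrite mul0r integral0_eq// => y _; rewrite mul0r.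
  rewrite mul1r EFin_pint//; last exact: iFx.
  rewrite [RHS]integral_mkcond restrict_EFin restrict_pos.
  by apply: eq_integral => y _ /=; rewrite mul1r.
have Fb2 y : (\int[mu]_x Fb (x, y))%E = (((0 < y)%R)%:R * pint (F ^~ y))%:E.
  rewrite /Fb/=; have [y0|y0] := ltP 0 y; last first.
    by rewrite mul0r integral0_eq// => x _; rewrite mul0r mulr0.
  rewrite mul1r EFin_pint//; last exact: iF.
  rewrite [RHS]integral_mkcond restrict_EFin restrict_pos.
  by apply: eq_integral => x _ /=; rewrite mul1r.
(* By Tonelli it is enough that one iterated integral of |F| is finite, and that one is bounded by
   the iterated integral of [G]. *)
have iFb : (mu \x mu)%E.-integrable setT Fb.
  apply/integrable12ltyP => //.
  have /integrableP[mGG] := (pintegrable_setT (fun x => pint (G x))).1 iiG.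
  apply: le_lt_trans; apply: ge0_le_integral => //=.
  - by move=> x _; exact: integral_ge0.
  - by have /= := @measurable_fun_fubini_tonelli_F _ _ _ _ _ mu (abse \o Fb); apply => //; exact: measurableT_comp.
  - by apply/measurable_EFinP; apply: measurableT_comp => //; exact/measurable_EFinP.
  move=> x _.
  rewrite /Fb/=; have [x0|x0] := ltP 0 x; last first.
    by rewrite mul0r normr0 integral0_eq// => y _; rewrite mul0r normr0.
  rewrite mul1r ger0_norm; last first.
    by apply: pint_ge0 => y y0; exact: le_trans (FG _ _ x0 y0).
  rewrite EFin_pint//; last exact: iG.
  rewrite [leRHS]integral_mkcond restrict_EFin restrict_pos.
  apply: ge0_le_integral => //=.
  - apply/measurable_EFinP; apply: measurableT_comp => //; apply: measurable_funM => //.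
    apply: measurable_funM; first exact: measurable_fun_ltrb.
    exact: (measurableT_comp mF (pair1_measurable x)).
  - by have /integrableP[] := (pintegrable_setT _).1 (iG x x0).
  move=> y _; rewrite mul1r lee_fin normrM normr_nat.
  by have [y0|y0] := ltP 0 y; rewrite ?mul0r// !mul1r FG.
have E := Fubini iFb; split.
  move: E; under eq_integral do rewrite Fb1.
  under [in X in _ = X -> _]eq_integral do rewrite Fb2.
  by rewrite !pint_setT /Rintegral => ->.
apply/pintegrable_setT.
have /measurable_EFinP mI : measurable_fun setT (fun y : R => (((0 < y)%R)%:R * pint (F ^~ y))%:E).
  rewrite (_ : (fun y => _) = fubini_G mu Fb); first exact: (measurable_fubini_G iFb).
  by apply/funext => y; rewrite -Fb2.
apply/integrableP; split; first exact/measurable_EFinP.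
have lty := (integrable21ltyP mu mu mFb).1 iFb; apply: le_lt_trans lty.
apply: ge0_le_integral => //=.
- by apply/measurable_EFinP; exact: measurableT_comp.
- by have /= := @measurable_fun_fubini_tonelli_G _ _ _ _ _ mu (abse \o Fb); apply => //; exact: measurableT_comp.
move=> y _; rewrite -abse_EFin -Fb2; apply: le_abse_integral => //.
exact: (measurableT_comp mFb (pair2_measurable y)).
Qed.

End Fubini.

(** * Fundamental theorem of calculus on the open half-line *)

Section ImproperFTC.
Context {R : realType}.
Local Notation mu := (@lebesgue_measure R).
Implicit Types (f F : R -> R).

Lemma is_derive_continuous f (x d : R) : is_derive x 1 f d -> {for x, continuous f}.
Proof. by move=> [fd _]; apply/differentiable_continuous/derivable1_diffP. Qed.

Lemma derive1_is_derive f (x d : R) : is_derive x 1 f d -> f^`()%classic x = d.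
Proof. by move=> fd; rewrite derive1E; exact: derive_val. Qed.

(** The segments [1/(n+2), n+2] exhaust the half-line; the shift by two gives a n < 1 < b n already
    at n = 0. *)
Let a n : R := n.+2%:R^-1.
Let b n : R := n.+2%:R.

Let ab n : a n < b n.
Proof.
rewrite /a /b; apply: (@lt_trans _ _ 1); last by rewrite ltr1n.
by rewrite invf_lt1 ?ltr1n.
Qed.

Let a0 n : 0 < a n. Proof. by rewrite invr_gt0. Qed.

Let segments_cover : \bigcup_n `[a n, b n] = (`]0, +oo[ : set R).
Proof.
apply/seteqP; split => x /=.
  by move=> [n _ /=]; rewrite !in_itv/= andbT => /andP[h _]; exact: lt_le_trans h.
rewrite in_itv/= andbT => x0.
pose n := maxn (Num.trunc x) (Num.trunc x^-1).
have le_b : x <= b n.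
  rewrite /b; apply: ltW; apply: lt_le_trans (truncnS_gt x) _.
  by rewrite ler_nat ltnS leqW// leq_maxl.
exists n => //=; rewrite in_itv/= le_b andbT /a invf_ple ?posrE//.
apply: ltW; apply: lt_le_trans (truncnS_gt x^-1) _.
by rewrite ler_nat ltnS leqW// leq_maxr.
Qed.

Let segments_nd : {homo (fun n => `[a n, b n] : set R) : n m / (n <= m)%N >-> (n <= m)%O}.
Proof.
move=> n m nm; apply/subsetPset => x /=; rewrite !in_itv/= => /andP[ax xb].
apply/andP; split.
  apply: le_trans ax; rewrite /a lef_pV2 ?posrE//.
  by rewrite ler_nat !ltnS.
by apply: le_trans xb _; rewrite ler_nat !ltnS.
Qed.

Let FTC_segment f F n : (forall x : R, 0 < x -> {for x, continuous f}) ->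
  (forall x : R, 0 < x -> is_derive x 1 F (f x)) ->
  (\int[mu]_(x in `[a n, b n]) (f x)%:E = (F (b n) - F (a n))%:E)%E.
Proof.
move=> cf dF; rewrite (continuous_FTC2 (F := F))//.
- apply: continuous_in_subspaceT => x /[!inE]/=; rewrite in_itv/= => /andP[ax _].
  by apply: cf; exact: lt_le_trans ax.
- split.
  + move=> x; rewrite in_itv/= => /andP[ax _].
    by have [] := dF x (lt_trans (a0 n) ax).
  + apply: cvg_at_right_filter; exact: is_derive_continuous (dF _ (a0 n)).
  + apply: cvg_at_left_filter; exact: is_derive_continuous (dF _ (lt_trans (a0 n) (ab n))).
- move=> x; rewrite in_itv/= => /andP[ax _].
  by rewrite (derive1_is_derive (dF x (lt_trans (a0 n) ax))).
Qed.

Lemma pos_continuous_measurable f : (forall x : R, 0 < x -> {for x, continuous f}) ->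
  measurable_fun (`]0, +oo[ : set R) f.
Proof.
move=> cf; apply: open_continuous_measurable_fun; first exact: interval_open.
by move=> x /[!inE]/=; rewrite in_itv/= andbT => /cf.
Qed.

(** Monotone convergence along the segments: each partial integral is F(b n) - F(a n), hence at most
    2M. *)
Lemma pintegrable_bounded_primitive f F (M : R) :
  (forall x : R, 0 < x -> 0 <= f x) -> (forall x : R, 0 < x -> {for x, continuous f}) ->
  (forall x : R, 0 < x -> is_derive x 1 F (f x)) -> (forall x : R, 0 < x -> `|F x| <= M) ->
  pintegrable f.
Proof.
move=> f0 cf dF FM.
have mf : measurable_fun (`]0, +oo[ : set R) (EFin \o f).
  by apply/measurable_EFinP; exact: pos_continuous_measurable.
have S0 n x : `[a n, b n]%classic x -> 0 < x.
  by rewrite /= in_itv/= => /andP[ax _]; exact: lt_le_trans ax.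
apply/integrableP; split => //.
have -> : (\int[mu]_(x in `]0%R, +oo[) `|(EFin \o f) x| = \int[mu]_(x in `]0%R, +oo[) (EFin \o f) x)%E.
  apply: eq_integral => x; rewrite inE/= in_itv/= andbT => /f0 fx; by rewrite ger0_norm.
rewrite -segments_cover.
have := @ge0_nondecreasing_set_cvg_integral _ (measurableTypeR R) R (fun n => `[a n, b n]) (EFin \o f) mu segments_nd.
move=> /(_ _ _ _)/cvg_lim <- //.
- apply: (@le_lt_trans _ _ (M + M)%:E); last exact: ltry.
  apply: lime_le.
    apply: ereal_nondecreasing_is_cvgn => n m nm.
    apply: ge0_subset_integral => //=.
    + apply: measurable_funS mf => // x /S0 x0 /=; by rewrite in_itv/= x0.
    + by move=> x /S0/f0.
    + by apply/subsetPset; exact: segments_nd.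
  apply: nearW => n; rewrite /= (FTC_segment n cf dF) lee_fin.
  have := FM _ (a0 n); have := FM _ (lt_trans (a0 n) (ab n)).
  by rewrite !ler_norml => /andP[? ?] /andP[? ?]; lra.
- move=> n; apply: measurable_funS mf => // x /S0 x0 /=; by rewrite in_itv/= x0.
- by move=> n x /S0/f0.
Qed.

(** Dominated convergence along the same segments, with |f| as majorant. Only one-sided limits of
    [F] enter, so primitives that are singular or meaningless at 0 are allowed. *)
Lemma pint_FTC f F (A B : R) : pintegrable f ->
  (forall x : R, 0 < x -> {for x, continuous f}) ->
  (forall x : R, 0 < x -> is_derive x 1 F (f x)) ->
  F x @[x --> 0^'+] --> A -> F x @[x --> +oo] --> B -> pint f = B - A.
Proof.
move=> fi cf dF FA FB.
have mf : measurable_fun (`]0, +oo[ : set R) (EFin \o f).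
  by apply/measurable_EFinP; exact: pos_continuous_measurable.
have S0 n x : `[a n, b n]%classic x -> 0 < x.
  by rewrite /= in_itv/= => /andP[ax _]; exact: lt_le_trans ax.
have fS x : 0 < x -> \forall n \near \oo, `[a n, b n]%classic x.
  move=> x0; have : (\bigcup_n `[a n, b n]) x by rewrite segments_cover/= in_itv/= x0.
  by move=> [N _ xN]; exists N => // n Nn; by have /subsetPset := segments_nd Nn; exact.
pose f_ n := (EFin \o f) \_ (`[a n, b n] : set R).
have /= := @dominated_convergence _ _ _ mu `]0, +oo[ _ f_ (EFin \o f) (EFin \o (fun x => `|f x|)).
case => //.
- move=> n; apply: (measurable_restrict _ _ _).1 => //.
  by apply: measurable_funS mf => // x [].
- apply: aeW => x /=; rewrite in_itv/= andbT => /fS xS.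
  apply: cvg_near_cst; near=> n; rewrite /f_ patchE mem_set//.
  by near: n.
- exact (pintegrable_norm fi).
- apply: aeW => x n _; rewrite /f_ patchE; case: ifPn => //= _.
  by rewrite /point/= lee_fin normr0.
move=> _ _ cvgf.
apply/EFin_inj; rewrite EFin_pint//.
apply: (cvg_unique _ cvgf) => //.
rewrite (_ : (fun n => _) = (fun n => (F (b n) - F (a n))%:E)); last first.
  apply/funext => n /=; rewrite -(FTC_segment n cf dF) [RHS]integral_mkcond /f_.
  rewrite [LHS]integral_mkcond; congr (integral _ _ _); apply/funext => x.
  rewrite /patch /=; have [xS|//] := boolP (x \in (`[a n, b n] : set R)); last by case: ifP.
  by rewrite mem_set//= in_itv/= andbT; apply: (S0 n); exact: set_mem xS.
apply: cvg_EFin; first by apply: nearW.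
apply: cvgB.
- apply: (cvg_comp b F _ FB).
  rewrite (_ : b = (fun n => (n + 2)%:R)); last by apply/funext => n; rewrite addn2.
  apply: (cvg_comp (fun n => (n + 2)%N) (fun n => n%:R : R) (cvg_addnr 2)); exact: cvgr_idn.
- move/cvg_at_rightP : FA => /(_ a); apply; split => //.
  rewrite (_ : a = (fun n => harmonic (n + 1)%N)); last first.
    by apply/funext => n; rewrite /harmonic/= addn1.
  apply: (cvg_comp (fun n => (n + 1)%N) harmonic (cvg_addnr 1)); exact: cvg_harmonic.
Unshelve. all: by end_near. Qed.

End ImproperFTC.

(** * Syntax-directed differentiation *)

Section Derivation.
Context {R : realType}.
Implicit Types (f g : R -> R) (x df dg : R).

Lemma is_derive_fun_add f g x df dg : is_derive x 1 f df -> is_derive x 1 g dg ->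
  is_derive x 1 (fun y => f y + g y) (df + dg).
Proof. by move=> ? ?; exact: is_deriveD. Qed.

Lemma is_derive_fun_opp f x df : is_derive x 1 f df ->
  is_derive x 1 (fun y => - f y) (- df).
Proof. by move=> ?; exact: is_deriveN. Qed.

Lemma is_derive_fun_mul f g x df dg : is_derive x 1 f df -> is_derive x 1 g dg ->
  is_derive x 1 (fun y => f y * g y) (df * g x + f x * dg).
Proof.
move=> fd gd; have H := @is_deriveM _ _ f g x 1 df dg fd gd.
by apply: (is_derive_eq H); rewrite /GRing.scale/= addrC [in RHS]mulrC.
Qed.

Lemma is_derive_fun_inv f x df : is_derive x 1 f df -> f x != 0 ->
  is_derive x 1 (fun y => (f y)^-1) (- df / f x ^+ 2).
Proof.
move=> fd fx0; apply: (is_derive_eq (is_deriveV fx0 fd)).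
by rewrite /GRing.scale/= mulNr mulrC mulNr.
Qed.

Lemma is_derive_fun_exprn f n x df : is_derive x 1 f df ->
  is_derive x 1 (fun y => f y ^+ n) (n%:R * f x ^+ n.-1 * df).
Proof.
move=> fd; elim: n => [|[|n] IH].
- by rewrite !mul0r; under eq_fun do rewrite expr0; exact: is_derive_cst.
- by rewrite expr0 !mul1r; under eq_fun do rewrite expr1.
- under eq_fun do rewrite exprS.
  apply: is_derive_eq (is_derive_fun_mul fd IH) _.
  by rewrite /= !exprS [in RHS]mulrSr; ring.
Qed.

Lemma is_derive_fun_expR f x df : is_derive x 1 f df ->
  is_derive x 1 (fun y => expR (f y)) (df * expR (f x)).
Proof. by move=> ?; rewrite mulrC; apply: (is_derive1_comp (f := expR)). Qed.

Lemma is_derive_fun_ln f x df : is_derive x 1 f df -> 0 < f x ->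
  is_derive x 1 (fun y => ln (f y)) (df / f x).
Proof.
move=> ? f0; rewrite mulrC; apply: (is_derive1_comp (f := @ln R)).
exact: is_derive1_ln.
Qed.

Lemma is_derive_congr f x df df' : is_derive x 1 f df -> df = df' -> is_derive x 1 f df'.
Proof. by move=> ? <-. Qed.

Lemma is_derive_cvg_at_right f x df (A : R) : is_derive x 1 f df -> f x = A ->
  f y @[y --> x^'+] --> A.
Proof. by move=> /is_derive_continuous cf <-; exact: cvg_at_right_filter. Qed.

Lemma is_derive_addl c x : is_derive x 1 (+%R c) 1.
Proof.
apply: is_derive_congr (is_derive_fun_add (is_derive_cst c x 1) (is_derive_id x 1)) _.
by rewrite add0r.
Qed.

Lemma is_derive_mull c x : is_derive x 1 ( *%R c) c.
Proof.
apply: is_derive_congr (is_derive_fun_mul (is_derive_cst c x 1) (is_derive_id x 1)) _.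
by rewrite mul0r add0r mulr1.
Qed.

Lemma is_derive_inv x : x != 0 -> is_derive x 1 (@GRing.inv R) (-1 / x ^+ 2).
Proof. by move=> x0; exact: (is_derive_fun_inv (is_derive_id x 1)). Qed.

End Derivation.

(** The derivative is built as an existential variable by recursion on the syntax. Conditions for
    inverses and logarithms are left as goals, ahead of the final equation of [derive_to].
    Derivatives of other functions are taken from the context, which explains the anonymous
    hypotheses introduced before each call. *)
Ltac is_der := lazymatch goal with
  | |- is_derive _ _ (fun=> ?c) _ => exact: is_derive_cst
  | |- is_derive _ _ (fun y => y) _ => exact: is_derive_id
  | |- is_derive _ _ (fun y => @?f y + @?g y) _ => eapply is_derive_fun_add; is_der
  | |- is_derive _ _ (fun y => - (@?f y)) _ => eapply is_derive_fun_opp; is_der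
  | |- is_derive _ _ (fun y => @?f y * @?g y) _ => eapply is_derive_fun_mul; is_der
  | |- is_derive _ _ (fun y => (@?f y) ^-1) _ => eapply is_derive_fun_inv; [is_der|cbn beta]
  | |- is_derive _ _ (fun y => (@?f y) ^+ ?n) _ => eapply is_derive_fun_exprn; is_der
  | |- is_derive _ _ (fun y => expR (@?f y)) _ => eapply is_derive_fun_expR; is_der
  | |- is_derive _ _ (fun y => ln (@?f y)) _ => eapply is_derive_fun_ln; [is_der|cbn beta]
  | |- is_derive _ _ (+%R _) _ => exact: is_derive_addl
  | |- is_derive _ _ ( *%R _) _ => exact: is_derive_mull
  | |- is_derive _ _ GRing.inv _ => eapply is_derive_inv
  | |- is_derive _ _ -%R _ => exact: is_deriveNid
  | |- is_derive _ _ expR _ => exact: is_derive_expR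
  | |- is_derive _ _ (@ln _) _ => eapply is_derive1_ln
  | |- _ => eassumption || eauto
  end.


Ltac derive_to := eapply is_derive_congr; [is_der|rewrite /=].


(** * The Laplace transform and its derivative *)

Section Laplace.
Context {R : realType}.
Local Notation mu := (@lebesgue_measure R).
Implicit Types (v w : R -> R) (t u : R).

Definition laplaceable w := forall t : R, 0 < t -> pintegrable (fun u => expR (- (t * u)) * w u).

Definition laplace w t := pint (fun u => expR (- (t * u)) * w u).

Lemma measurable_expRM t D : measurable_fun D (fun u => expR (- (t * u)) : R).
Proof. by apply: measurable_fun_expR; apply: measurableT_comp => //; exact: measurable_funM. Qed.

Lemma laplaceable_measurable w : laplaceable w -> measurable_fun (`]0, +oo[ : set R) w.
Proof.
move=> /(_ _ ltr01)/pintegrable_measurable mw.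
rewrite (_ : w = fun u => expR (- (-1 * u)) * (expR (- (1 * u)) * w u)).
  by apply: measurable_funM => //; exact: measurable_expRM.
by apply/funext => u; rewrite mulrA -expRD mulN1r mul1r opprK subrr expR0 mul1r.
Qed.

Lemma laplaceable_le v w : measurable_fun (`]0, +oo[ : set R) w -> laplaceable v ->
  (forall u : R, 0 < u -> `|w u| <= v u) -> laplaceable w.
Proof.
move=> mw lv wv t t0; apply: pintegrable_le (lv _ t0) _.
  by apply: measurable_funM => //; exact: measurable_expRM.
move=> u u0; rewrite normrM gtr0_norm ?expR_gt0//.
by rewrite ler_pM2l ?expR_gt0// wv.
Qed.

Lemma eq_laplace v w t : (forall u : R, 0 < u -> v u = w u) -> laplace v t = laplace w t.
Proof. by move=> vw; apply: eq_pint => u u0; rewrite vw. Qed.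

Lemma eq_laplaceable v w : (forall u : R, 0 < u -> w u = v u) -> laplaceable v -> laplaceable w.
Proof. by move=> vw lv t t0; apply: eq_pintegrable (lv _ t0) => u u0; rewrite vw. Qed.

Lemma laplaceableD v w : laplaceable v -> laplaceable w -> laplaceable (fun u => v u + w u).
Proof.
move=> lv lw t t0; apply: eq_pintegrable (pintegrableD (lv _ t0) (lw _ t0)) => u _.
by rewrite mulrDr.
Qed.

Lemma laplaceableZ c w : laplaceable w -> laplaceable (fun u => c * w u).
Proof.
move=> lw t t0; apply: eq_pintegrable (pintegrableZ c (lw _ t0)) => u _.
by rewrite mulrCA.
Qed.

Lemma laplaceD v w t : 0 < t -> laplaceable v -> laplaceable w ->
  laplace (fun u => v u + w u) t = laplace v t + laplace w t.
Proof.
move=> t0 lv lw; rewrite -pintD; [|exact: lv|exact: lw].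
by apply: eq_pint => u _; rewrite mulrDr.
Qed.

Lemma laplaceZ c w t : 0 < t -> laplaceable w ->
  laplace (fun u => c * w u) t = c * laplace w t.
Proof.
move=> t0 lw; rewrite -pintZ; last exact: lw.
by apply: eq_pint => u _; rewrite mulrCA.
Qed.

Lemma le_laplace v w t : 0 < t -> laplaceable v -> laplaceable w ->
  (forall u : R, 0 < u -> v u <= w u) -> laplace v t <= laplace w t.
Proof.
move=> t0 lv lw vw; apply: le_pint; [exact: lv|exact: lw|].
by move=> u u0; rewrite ler_pM2l ?expR_gt0// vw.
Qed.

Lemma laplace_ge0 w t : (forall u : R, 0 < u -> 0 <= w u) -> 0 <= laplace w t.
Proof. by move=> w0; apply: pint_ge0 => u u0; rewrite mulr_ge0 ?expR_ge0 ?w0. Qed.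

Lemma laplaceable_norm w : laplaceable w -> laplaceable (fun u => `|w u|).
Proof.
move=> lw t t0; apply: eq_pintegrable (pintegrable_norm (lw _ t0)) => u _.
by rewrite normrM (gtr0_norm (expR_gt0 _)).
Qed.

(** Half of the exponential decay pays for the factor: (t/2) u <= e^(tu/2). Requiring integrability
    for every t > 0 is what makes the class stable under this. *)
Lemma laplaceable_mulid w : laplaceable w -> laplaceable (fun u => u * w u).
Proof.
move=> lw t t0.
have t20 : 0 < t / 2 by rewrite divr_gt0.
apply: pintegrable_le (pintegrableZ (t / 2)^-1 (laplaceable_norm lw t20)) _.
  apply: measurable_funM; first exact: measurable_expRM.
  by apply: measurable_funM => //; exact: laplaceable_measurable.
move=> u u0; rewrite normrM normrM gtr0_norm ?expR_gt0// (gtr0_norm u0).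
have -> : expR (- (t * u)) = expR (- (t / 2 * u)) * expR (- (t / 2 * u)).
  by rewrite -expRD; congr expR; field.
set E := expR _; have E0 : 0 <= E by exact: expR_ge0.
have -> : E * E * (u * `|w u|) = (E * `|w u|) * (E * u) by ring.
rewrite [leRHS]mulrC ler_wpM2l ?mulr_ge0//.
rewrite /E expRN ler_pdivrMl ?expR_gt0// ler_pdivlMr// mulrC.
by apply: le_trans (expR_ge1Dx _); rewrite lerDr.
Qed.

Lemma laplaceable_powid n w : laplaceable w -> laplaceable (fun u => u ^+ n * w u).
Proof.
move=> lw; elim: n => [|n IH].
  by apply: eq_laplaceable lw => u _; rewrite expr0 mul1r.
by apply: eq_laplaceable (laplaceable_mulid IH) => u _; rewrite exprS mulrA.
Qed.

Lemma laplaceable1 : laplaceable (fun=> 1).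
Proof.
move=> t t0; apply: (@pintegrable_bounded_primitive _ _ (fun u => - t^-1 * expR (- (t * u))) t^-1).
- by move=> u _; rewrite mulr1 expR_ge0.
- move=> u _; apply: is_derive_continuous; is_der.
- by move=> u _; derive_to; field; rewrite gt_eqF.
- move=> u u0; rewrite normrM normrN !gtr0_norm ?invr_gt0 ?expR_gt0//.
  by rewrite ler_piMr ?invr_ge0 1?ltW// expR_lt1 oppr_lt0 mulr_gt0.
Qed.

Lemma laplaceable_cst c : laplaceable (fun=> c).
Proof. by apply: eq_laplaceable (laplaceableZ c laplaceable1) => u _; rewrite mulr1. Qed.

Lemma cvg_expRMy t : 0 < t -> expR (- (t * u)) @[u --> +oo] --> (0 : R).
Proof.
move=> t0; apply: (cvg_comp (fun u => t * u) (fun x => expR (- x))); last exact: cvgr_expR.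
by apply: gt0_cvgMry => //; exact: cvg_id.
Qed.

Lemma laplace1 t : 0 < t -> laplace (fun=> 1) t = t^-1.
Proof.
move=> t0; rewrite /laplace.
transitivity (0 - - t^-1); last by rewrite sub0r opprK.
apply: (@pint_FTC _ _ (fun u => - t^-1 * expR (- (t * u)))).
- exact: laplaceable1.
- by move=> u _; apply: is_derive_continuous; is_der.
- by move=> u _; derive_to; field; rewrite gt_eqF.
- eapply is_derive_cvg_at_right; first is_der.
  by rewrite /= mulr0 oppr0 expR0 mulr1.
- by rewrite -[X in _ --> X](mulr0 (- t^-1)); apply: cvgM; [exact: cvg_cst|exact: cvg_expRMy].
Qed.

Lemma laplace_cst c t : 0 < t -> laplace (fun=> c) t = c / t.
Proof.
move=> t0; rewrite -laplace1// -laplaceZ//; last exact: laplaceable1.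
by apply: eq_laplace => u _; rewrite mulr1.
Qed.

(** Differentiation under the integral sign for parameters in ]t/2, 2t[, where the derived kernel is
    dominated by e^(-tu/2) |u w(u)|. *)
Lemma is_derive_laplace w t : 0 < t -> laplaceable w ->
  is_derive t 1 (laplace w) (- laplace (fun u => u * w u) t).
Proof.
move=> t0 lw.
have dk (x u : R) : is_derive x 1 (fun x => expR (- (x * u)) * w u) (- u * (expR (- (x * u)) * w u)).
  by derive_to; ring.
have t20 : 0 < t / 2 by rewrite divr_gt0.
have tI : (`]t / 2, 2 * t[ : set R) t by rewrite /= in_itv/=; apply/andP; split; lra.
have intf (x : R) : (`]t / 2, 2 * t[ : set R) x -> pintegrable (fun u => expR (- (x * u)) * w u).
  by rewrite /= in_itv/= => /andP[tx _]; apply: lw; exact: lt_trans tx.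
have derf (x u : R) : (`]t / 2, 2 * t[ : set R) x -> (`]0, +oo[ : set R) u ->
    derivable (fun x : R => expR (- (x * u)) * w u) x 1.
  by move=> _ _; have [] := dk x u.
pose G (u : R) := expR (- (t / 2 * u)) * `|u * w u|.
have G0 u : 0 <= G u by rewrite mulr_ge0 ?expR_ge0.
have iG : pintegrable G by exact: (laplaceable_norm (laplaceable_mulid lw)).
have pE (x u : R) : partial1of2 (fun x u : R => expR (- (x * u)) * w u) x u = - u * (expR (- (x * u)) * w u).
  by rewrite /partial1of2; exact: derive1_is_derive.
have Gub (x u : R) : (`]t / 2, 2 * t[ : set R) x -> (`]0, +oo[ : set R) u ->
    `|partial1of2 (fun x u : R => expR (- (x * u)) * w u) x u| <= G u.
  rewrite /= !in_itv/= andbT => /andP[tx _] u0.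
  rewrite pE mulNr normrN mulrCA normrM gtr0_norm ?expR_gt0//.
  by rewrite ler_wpM2r// ler_expR lerN2 ler_pM2r// ltW.
have mP : measurable (`]0, +oo[ : set R) by exact: measurable_itv.
have d := @derivable_under_integral R _ (measurableTypeR R) mu (fun x u : R => expR (- (x * u)) * w u) `]0, +oo[ mP _ _ _ tI intf derf _ G0 iG Gub.
have e := @differentiation_under_integral R _ (measurableTypeR R) mu (fun x u : R => expR (- (x * u)) * w u) `]0, +oo[ mP _ _ _ tI intf derf _ G0 iG Gub.
apply: DeriveDef; first exact: d.
rewrite -derive1E [LHS]e -pintN; last exact: laplaceable_mulid.
by apply: eq_pint => u _; rewrite pE; ring.
Qed.

End Laplace.

(** * The kernel [h]: monotonicity, limit at 0, Lipschitz bound *)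

Section KernelH.
Context {R : realType}.
Implicit Types (x u v : R).

Lemma MVT_from0 (f df : R -> R) x : (forall y : R, is_derive y 1 f (df y)) -> f 0 = 0 ->
  0 < x -> exists c, [/\ 0 < c, c < x & f x = df c * x].
Proof.
move=> fd f0 x0.
have cf : {within `[0, x], continuous f}.
  by apply: continuous_subspaceT => y; exact: is_derive_continuous (fd y).
have [c] := MVT x0 (fun y _ => fd y) cf.
by rewrite in_itv/= f0 !subr0 => /andP[c0 cx] ->; exists c.
Qed.

Lemma derive_pos_gt0 (f df : R -> R) : (forall y : R, is_derive y 1 f (df y)) -> f 0 = 0 ->
  (forall y : R, 0 < y -> 0 < df y) -> forall x : R, 0 < x -> 0 < f x.
Proof.
move=> fd f0 df0 x x0; have [c [c0 _ ->]] := MVT_from0 fd f0 x0.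
by rewrite mulr_gt0// df0.
Qed.

Lemma derive_le_ge0 (f df : R -> R) (a : R) : (forall y : R, is_derive y 1 f (df y)) -> f 0 = 0 ->
  (forall y : R, 0 < y -> y <= a -> 0 <= df y) -> forall x : R, 0 < x -> x <= a -> 0 <= f x.
Proof.
move=> fd f0 df0 x x0 xa; have [c [c0 cx ->]] := MVT_from0 fd f0 x0.
by rewrite mulr_ge0 ?df0 1?ltW// (lt_le_trans cx).
Qed.

(** [S u] is 4 sinh(u/2)^2, so h = 1/u^2 - 1/S, and [T u] is 2 sinh u. As S' = T and T' = S + 2,
    each polynomial bound below follows from the previous one by integrating from 0. The upper
    bounds start from e^u <= 2 and hold only for u <= 1/2. *)
Let S u : R := expR u + expR (- u) - 2.
Let T u : R := expR u - expR (- u).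

Let dS u : is_derive u 1 S (T u).
Proof. by rewrite /S /T; derive_to; ring. Qed.

Let dT u : is_derive u 1 T (S u + 2).
Proof. by rewrite /S /T; derive_to; ring. Qed.

Let S00 : S 0 = 0. Proof. by rewrite /S oppr0 expR0; ring. Qed.
Let T00 : T 0 = 0. Proof. by rewrite /T oppr0 expR0; ring. Qed.

Let T_gt0 u : 0 < u -> 0 < T u.
Proof. by move=> u0; rewrite subr_gt0 ltr_expR; lra. Qed.

Let S_gt0 u : 0 < u -> 0 < S u.
Proof. by move: u; exact: (derive_pos_gt0 dS). Qed.

Let T_gt u : 0 < u -> 2 * u < T u.
Proof.
move=> u0; rewrite -subr_gt0; move: u u0; apply: (@derive_pos_gt0 (fun u => T u - (2 * u)) (fun u => S u)).
- by move=> y; have ? := dT y; derive_to; ring.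
- by rewrite T00 mulr0 subr0.
- by move=> y; exact: S_gt0.
Qed.

Let S_gt u : 0 < u -> u ^+ 2 < S u.
Proof.
move=> u0; rewrite -subr_gt0; move: u u0; apply: (@derive_pos_gt0 (fun u => S u - (u ^+ 2)) (fun u => T u - 2 * u)).
- by move=> y; have ? := dS y; derive_to; ring.
- by rewrite S00 expr0n subr0.
- by move=> y y0; rewrite subr_gt0 T_gt.
Qed.

Let T_gt3 u : 0 < u -> 2 * u + u ^+ 3 / 3 < T u.
Proof.
move=> u0; rewrite -subr_gt0; move: u u0; apply: (@derive_pos_gt0 (fun u => T u - (2 * u + u ^+ 3 / 3)) (fun u => S u - u ^+ 2)).
- by move=> y; have ? := dT y; derive_to; field.
- by rewrite T00 expr0n/= mul0r mulr0 addr0 subr0.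
- by move=> y y0; rewrite subr_gt0 S_gt.
Qed.

Let S_gt4 u : 0 < u -> u ^+ 2 + u ^+ 4 / 12 < S u.
Proof.
move=> u0; rewrite -subr_gt0; move: u u0; apply: (@derive_pos_gt0 (fun u => S u - (u ^+ 2 + u ^+ 4 / 12)) (fun u => T u - (2 * u + u ^+ 3 / 3))).
- by move=> y; have ? := dS y; derive_to; field.
- by rewrite S00 !expr0n/= mul0r addr0 subr0.
- by move=> y y0; rewrite subr_gt0 T_gt3.
Qed.

Let T_le u : 0 < u -> u <= 2^-1 -> T u <= 4 * u.
Proof.
move=> u0 u2; rewrite -subr_ge0; move: u u0 u2; apply: (@derive_le_ge0 (fun u => 4 * u - (T u)) (fun u => 2 - S u)).
- by move=> y; have ? := dT y; derive_to; ring.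
- by rewrite T00 mulr0 subr0.
move=> y y0 y2; rewrite subr_ge0 /S.
have : expR (- y) <= 1 by rewrite expR_le1; lra.
have : expR y <= 2.
  rewrite -[y]opprK expRN -[leRHS]invrK lef_pV2 ?posrE ?expR_gt0//.
  by apply: le_trans (expR_ge1Dx _); lra.
lra.
Qed.

Let S_le2 u : 0 < u -> u <= 2^-1 -> S u <= 2 * u ^+ 2.
Proof.
move=> u0 u2; rewrite -subr_ge0; move: u u0 u2; apply: (@derive_le_ge0 (fun u => 2 * u ^+ 2 - (S u)) (fun u => 4 * u - T u)).
- by move=> y; have ? := dS y; derive_to; ring.
- by rewrite S00 expr0n mulr0 subr0.
- by move=> y y0 y2; rewrite subr_ge0 T_le.
Qed.

Let T_le3 u : 0 < u -> u <= 2^-1 -> T u <= 2 * u + 2 / 3 * u ^+ 3.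
Proof.
move=> u0 u2; rewrite -subr_ge0; move: u u0 u2; apply: (@derive_le_ge0 (fun u => 2 * u + 2 / 3 * u ^+ 3 - (T u)) (fun u => 2 * u ^+ 2 - S u)).
- by move=> y; have ? := dT y; derive_to; field.
- by rewrite T00 expr0n/= !mulr0 addr0 subr0.
- by move=> y y0 y2; rewrite subr_ge0 S_le2.
Qed.

Let S_le4 u : 0 < u -> u <= 2^-1 -> S u <= u ^+ 2 + u ^+ 4 / 6.
Proof.
move=> u0 u2; rewrite -subr_ge0; move: u u0 u2;
  apply: (@derive_le_ge0 (fun u => u ^+ 2 + u ^+ 4 / 6 - (S u)) (fun u => 2 * u + 2 / 3 * u ^+ 3 - T u)).
- by move=> y; have ? := dS y; derive_to; field.
- by rewrite S00 !expr0n/= mul0r addr0 subr0.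
- by move=> y y0 y2; rewrite subr_ge0 T_le3.
Qed.

Let T_le5 u : 0 < u -> u <= 2^-1 -> T u <= 2 * u + u ^+ 3 / 3 + u ^+ 5 / 30.
Proof.
move=> u0 u2; rewrite -subr_ge0; move: u u0 u2;
  apply: (@derive_le_ge0 (fun u => 2 * u + u ^+ 3 / 3 + u ^+ 5 / 30 - (T u)) (fun u => u ^+ 2 + u ^+ 4 / 6 - S u)).
- by move=> y; have ? := dT y; derive_to; field.
- by rewrite T00 !expr0n/= !mul0r mulr0 !addr0 subr0.
- by move=> y y0 y2; rewrite subr_ge0 S_le4.
Qed.

Let S_le6 u : 0 < u -> u <= 2^-1 -> S u <= u ^+ 2 + u ^+ 4 / 12 + u ^+ 6 / 180.
Proof.
move=> u0 u2; rewrite -subr_ge0; move: u u0 u2;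
  apply: (@derive_le_ge0 (fun u => u ^+ 2 + u ^+ 4 / 12 + u ^+ 6 / 180 - (S u)) (fun u => 2 * u + u ^+ 3 / 3 + u ^+ 5 / 30 - T u)).
- by move=> y; have ? := dS y; derive_to; field.
- by rewrite S00 !expr0n/= !mul0r !addr0 subr0.
- by move=> y y0 y2; rewrite subr_ge0 T_le5.
Qed.

(* Lazarevic's inequality: the derivative of sinh x / cosh(x)^(1/3) - x is
   (a - 1)^2 (a + 2) / (3 a) with a = cosh(x)^(-2/3). *)
Lemma lazarevic x : 0 < x ->
  x ^+ 3 * ((expR x + expR (- x)) / 2) < ((expR x - expR (- x)) / 2) ^+ 3.
Proof.
move=> x0.
pose c y : R := (expR y + expR (- y)) / 2.
pose s y : R := (expR y - expR (- y)) / 2.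
have c0 y : 0 < c y by rewrite divr_gt0// addr_gt0 ?expR_gt0.
(* This is cosh(y)^(-1/3). With p^3 c = 1 and c^2 - s^2 = 1 the derivative of s p - y becomes a
   rational function of p alone, visibly nonnegative. *)
pose p y := expR (- (ln (c y) / 3)).
have p0 y : 0 < p y by exact: expR_gt0.
have p3 y : p y ^+ 3 * c y = 1.
  rewrite /p -expRM_natl -{2}[c y]lnK ?posrE// -expRD -[RHS]expR0.
  by congr expR; field.
have cs y : c y ^+ 2 - s y ^+ 2 = 1.
  rewrite /c /s; have := expRxMexpNx_1 y; set a := expR y; set b := expR (- y) => abE.
  by rewrite -[RHS]abE; field.
have dc (y : R) : is_derive y 1 c (s y) by rewrite /c /s; derive_to; field.
have ds (y : R) : is_derive y 1 s (c y) by rewrite /c /s; derive_to; field.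
pose F y := s y * p y - y.
have dF (y : R) : is_derive y 1 F ((p y ^+ 2 - 1) ^+ 2 * (p y ^+ 2 + 2) / (3 * p y ^+ 2)).
  have dcy := dc y; have dsy := ds y.
  rewrite /F /p; derive_to; first exact: c0.
  rewrite -/(p y).
  have cE : c y = (p y ^+ 3)^-1.
    by apply: (mulfI (expf_neq0 3 (lt0r_neq0 (p0 y)))); rewrite p3 divff// expf_neq0 ?lt0r_neq0.
  transitivity (p y * (c y - s y ^+ 2 / (3 * c y)) - 1); first by field; rewrite gt_eqF.
  have -> : s y ^+ 2 = c y ^+ 2 - 1 by rewrite -(cs y); ring.
  by rewrite cE; field; rewrite gt_eqF.
have F0 : F 0 = 0 by rewrite /F subr0 /s oppr0 subrr !mul0r.
have : 0 < F x.
  apply: (derive_pos_gt0 dF) => // y y0.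
  have c1 : 1 < c y.
    have := S_gt0 y0; rewrite /S /c ltr_pdivlMr//; lra.
  have p1 : p y < 1 by rewrite expR_lt1 oppr_lt0 divr_gt0// ln_gt0.
  have p2 : p y ^+ 2 < 1 by rewrite expr_lt1// ltW.
  apply: divr_gt0; last by rewrite mulr_gt0 ?exprn_gt0.
  apply: mulr_gt0; last by rewrite addr_gt0 ?exprn_gt0.
  by rewrite exprn_even_gt0//= subr_eq0 lt_eqF.
rewrite subr_gt0 => xsp.
have : x ^+ 3 < (s x * p x) ^+ 3 by rewrite ltrXn2r// ?nnegrE ltW// (lt_trans x0).
rewrite -(ltr_pM2r (c0 x)) => /lt_le_trans; apply.
by rewrite exprMn -mulrA p3 mulr1.
Qed.

Let hE u : 0 < u -> h u = (u ^+ 2)^-1 - (S u)^-1.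
Proof.
move=> u0; rewrite /h gt_eqF//; congr (_ - _); first by rewrite mul1r.
rewrite mul1r; congr (_^-1); rewrite /sinh /S.
have e1 : expR u = expR (u / 2) ^+ 2 by rewrite -expRM_natl; congr expR; field.
have e2 : expR (- u) = expR (- (u / 2)) ^+ 2 by rewrite -expRM_natl; congr expR; field.
have := expRxMexpNx_1 (u / 2); rewrite e1 e2.
set a := expR (u / 2); set b := expR (- (u / 2)) => ab.
transitivity (a ^+ 2 + b ^+ 2 - 2 * (a * b)); first by field.
by rewrite ab mulr1.
Qed.

Definition dh u : R := - 2 / u ^+ 3 + (expR u - expR (- u)) / (expR u + expR (- u) - 2) ^+ 2.

Lemma is_derive_h u : 0 < u -> is_derive u 1 h (dh u).
Proof.
move=> u0; apply: (@near_eq_is_derive _ _ _ (fun u => (u ^+ 2)^-1 - (S u)^-1)).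
  near=> v; rewrite hE//; near: v; exact: lt_nbhsr.
have dSu := dS u; have ? : S u != 0 by rewrite gt_eqF// S_gt0.
derive_to; [by rewrite expf_neq0// gt_eqF|by []|].
by rewrite /dh -/(T u) -/(S u); field; apply/andP; split => //; rewrite gt_eqF.
Unshelve. all: by end_near. Qed.

Let dhE u : 0 < u -> dh u = - ((2 * S u ^+ 2 - u ^+ 3 * T u) / (u ^+ 3 * S u ^+ 2)).
Proof.
move=> u0; rewrite /dh -/(T u) -/(S u); field.
by rewrite !gt_eqF ?S_gt0.
Qed.

(** With s = sinh(u/2) and c = cosh(u/2) the numerator 2 S^2 - u^3 T equals 32 s (s^3 - (u/2)^3 c),
    so its sign is Lazarevic's inequality at u/2. *)
Lemma dh_lt0 u : 0 < u -> dh u < 0.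
Proof.
move=> u0; rewrite dhE// oppr_lt0 divr_gt0// ?mulr_gt0 ?exprn_gt0 ?S_gt0// subr_gt0.
have := @lazarevic (u / 2); rewrite divr_gt0// => /(_ isT).
set a := expR (u / 2); set b := expR (- (u / 2)) => lz.
have ab : a * b = 1 by exact: expRxMexpNx_1.
have e1 : expR u = a ^+ 2 by rewrite -expRM_natl; congr expR; field.
have e2 : expR (- u) = b ^+ 2 by rewrite -expRM_natl; congr expR; field.
have SE : S u = 4 * ((a - b) / 2) ^+ 2.
  rewrite /S e1 e2; transitivity (a ^+ 2 + b ^+ 2 - 2 * (a * b)); last by field.
  by rewrite ab mulr1.
have TE : T u = 4 * ((a - b) / 2) * ((a + b) / 2) by rewrite /T e1 e2; field.
have sp : 0 < (a - b) / 2 by rewrite divr_gt0// subr_gt0 ltr_expR; lra.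
rewrite SE TE.
have -> : 2 * (4 * ((a - b) / 2) ^+ 2) ^+ 2 = 32 * ((a - b) / 2) * ((a - b) / 2) ^+ 3 by ring.
have -> : u ^+ 3 * (4 * ((a - b) / 2) * ((a + b) / 2)) =
  32 * ((a - b) / 2) * ((u / 2) ^+ 3 * ((a + b) / 2)) by field.
by rewrite ltr_pM2l// mulr_gt0.
Qed.

(** The constant is 2/u^3 at u = 1/2; beyond 1/2 the other term of [dh] is nonnegative. Below 1/2
    the denominator of -h' is at least u^7, and the terms of order u^4 and u^6 of 2 S^2 - u^3 T
    cancel, which is why [S] had to be bounded up to order u^6. *)
Lemma dh_ge u : 0 < u -> - 16 <= dh u.
Proof.
move=> u0; have [u2|u2] := leP u 2^-1; last first.
  rewrite /dh -/(T u) -/(S u).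
  have : 0 <= T u / S u ^+ 2 by rewrite divr_ge0 ?sqr_ge0// ltW// T_gt0.
  suff : 2 / u ^+ 3 <= 16 by rewrite mulNr; lra.
  rewrite ler_pdivrMr ?exprn_gt0//.
  have : (2^-1) ^+ 3 <= u ^+ 3 by rewrite lerXn2r ?nnegrE ?invr_ge0// ltW.
  lra.
rewrite dhE// lerN2 ler_pdivrMr ?mulr_gt0 ?exprn_gt0 ?S_gt0//.
have S4 : (u ^+ 2) ^+ 2 <= S u ^+ 2 by rewrite lerXn2r ?nnegrE ?sqr_ge0// ltW// ?S_gt0 ?S_gt.
have SL := S_le6 u0 u2.
have SU : S u ^+ 2 <= (u ^+ 2 + u ^+ 4 / 12 + u ^+ 6 / 180) ^+ 2.
  by apply: lerXn2r; rewrite ?nnegrE; [exact/ltW/S_gt0|exact: le_trans (ltW (S_gt0 u0)) SL|].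
have TL := ltW (T_gt3 u0).
have u30 : 0 <= u ^+ 3 by rewrite exprn_ge0// ltW.
apply: (@le_trans _ _ (16 * (u ^+ 3 * (u ^+ 2) ^+ 2))); last by rewrite ler_pM2l// ler_wpM2l.
have := ler_wpM2l u30 TL => TL'.
apply: (@le_trans _ _ (2 * (u ^+ 2 + u ^+ 4 / 12 + u ^+ 6 / 180) ^+ 2 - u ^+ 3 * (2 * u + u ^+ 3 / 3))).
  by lra.
rewrite -subr_ge0.
have -> : 16 * (u ^+ 3 * (u ^+ 2) ^+ 2) - (2 * (u ^+ 2 + u ^+ 4 / 12 + u ^+ 6 / 180) ^+ 2 -
  u ^+ 3 * (2 * u + u ^+ 3 / 3)) =
  u ^+ 7 * (16 - u * (13 / 360 + u ^+ 2 / 540 + u ^+ 4 / 16200)) by field.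
have u1 : u <= 1 by lra.
have u21 : u ^+ 2 <= 1 by rewrite exprn_ile1// ltW.
have u41 : u ^+ 4 <= 1 by rewrite exprn_ile1// ltW.
have u20 := sqr_ge0 u.
have u40 : 0 <= u ^+ 4 by rewrite exprn_ge0// ltW.
set q := _ + _ + _.
have q0 : 0 <= q by rewrite /q; lra.
have q1 : q <= 1 by rewrite /q; lra.
have uq : u * q <= 1 by rewrite mulr_ile1// ltW.
apply: mulr_ge0; first by rewrite exprn_ge0// ltW.
by lra.
Qed.

Lemma h_gt0 u : 0 < u -> 0 < h u.
Proof.
by move=> u0; rewrite hE// subr_gt0 ltf_pV2 ?posrE ?S_gt ?S_gt0 ?exprn_gt0.
Qed.

Let h_MVT u v : 0 < u -> u < v -> exists2 c, 0 < c & h v - h u = dh c * (v - u).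
Proof.
move=> u0 uv.
have cf : {within `[u, v], continuous h}.
  apply: continuous_in_subspaceT => y; rewrite inE/= in_itv/= => /andP[uy _].
  exact: is_derive_continuous (is_derive_h (lt_le_trans u0 uy)).
have [|c] := @MVT _ h dh _ _ uv _ cf.
  by move=> y; rewrite in_itv/= => /andP[uy _]; exact: is_derive_h (lt_trans u0 uy).
by rewrite in_itv/= => /andP[uc _] ->; exists c => //; exact: lt_trans uc.
Qed.

Lemma h_decr u v : 0 < u -> u < v -> h v < h u.
Proof.
move=> u0 uv; have [c c0 E] := h_MVT u0 uv.
by rewrite -subr_lt0 E nmulr_rlt0 ?dh_lt0// subr_gt0.
Qed.

(** Writing h = (S - u^2) / (u^2 S), the numerator is u^4/12 to leading order. The factor 1 - u^2/6
    on the left is matched to S <= u^2 (1 + u^2/6): their product stays below u^2, with defect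
    u^8/432 in the end. *)
Let h_near0 u : 0 < u -> u <= 2^-1 -> 12^-1 * (1 - u ^+ 2 / 6) <= h u <= 12^-1 + u ^+ 2.
Proof.
move=> u0 u2.
have hE' : h u = (S u - u ^+ 2) / (u ^+ 2 * S u).
  by rewrite hE//; field; rewrite !gt_eqF ?S_gt0.
have Su := S_gt0 u0; have Su2 := S_gt u0; have Su4 := S_gt4 u0; have Su4' := S_le4 u0 u2.
have Su6 := S_le6 u0 u2.
have u20 : 0 < u ^+ 2 by rewrite exprn_gt0.
have u40 : 0 < u ^+ 4 by rewrite exprn_gt0.
apply/andP; split.
  rewrite hE' ler_pdivlMr ?mulr_gt0//.
  apply: (@le_trans _ _ (u ^+ 4 / 12)); last lra.
  apply: (@le_trans _ _ (12^-1 * (1 - u ^+ 2 / 6) * (u ^+ 2 * (u ^+ 2 + u ^+ 4 / 6)))).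
    rewrite ler_wpM2l ?ler_wpM2l ?sqr_ge0// mulr_ge0 ?invr_ge0//.
    have u21 : u ^+ 2 <= 1 by rewrite exprn_ile1 1?ltW//; lra.
    lra.
  rewrite -subr_ge0.
  have -> : u ^+ 4 / 12 - 12^-1 * (1 - u ^+ 2 / 6) * (u ^+ 2 * (u ^+ 2 + u ^+ 4 / 6)) = u ^+ 8 / 432.
    by field.
  by apply: divr_ge0; [rewrite exprn_ge0// ltW|exact: ler0n].
rewrite hE' ler_pdivrMr ?mulr_gt0//.
apply: (@le_trans _ _ ((12^-1 + u ^+ 2) * (u ^+ 2 * u ^+ 2))).
  have -> : (12^-1 + u ^+ 2) * (u ^+ 2 * u ^+ 2) = u ^+ 4 / 12 + u ^+ 6 by field.
  have : 0 <= u ^+ 6 by rewrite exprn_ge0// ltW.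
  lra.
rewrite ler_wpM2l ?addr_ge0 ?invr_ge0 ?sqr_ge0// ler_wpM2l ?sqr_ge0//.
exact: ltW.
Qed.

(** The limit at 0 gives only h <= 1/12; strictness is gained by first passing from u to u/2 with
    [h_decr]. *)
Lemma h_lt u : 0 < u -> h u < 12^-1.
Proof.
move=> u0; apply: (@lt_le_trans _ _ (h (u / 2))).
  by apply: h_decr; rewrite ?divr_gt0//; lra.
apply/ler_addgt0Pl => e e0.
pose v := Num.min (Num.min 2^-1 e) (u / 4).
have v0 : 0 < v by rewrite !lt_min e0 invr_gt0 divr_gt0 ?ltr0n.
have v2 : v <= 2^-1 by rewrite !ge_min lexx.
have ve : v <= e by rewrite !ge_min lexx orbT.
have vu : v < u / 2 by apply: (@le_lt_trans _ _ (u / 4)); [rewrite ge_min lexx orbT|lra].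
have /andP[_ hv] := h_near0 v0 v2.
have := h_decr v0 vu.
have : v ^+ 2 <= v by rewrite expr2 ler_piMl 1?ltW//; lra.
lra.
Qed.

Lemma h_ge_near0 u : 0 < u -> u <= 2^-1 -> 24^-1 <= h u.
Proof.
move=> u0 u2; have /andP[+ _] := h_near0 u0 u2; apply: le_trans.
have u21 : u ^+ 2 <= 1 by rewrite exprn_ile1 1?ltW//; lra.
lra.
Qed.

Lemma h0 : h 0 = 12^-1 :> R.
Proof. by rewrite /h eqxx. Qed.

Lemma h_nincr u v : 0 <= u -> u <= v -> h v <= h u.
Proof.
rewrite le_eqVlt => /predU1P[<-|u0].
  rewrite le_eqVlt => /predU1P[<-//|v0]; by rewrite h0 ltW// h_lt.
rewrite le_eqVlt => /predU1P[->//|uv]; exact/ltW/h_decr.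
Qed.

Lemma h_le u : 0 <= u -> h u <= 12^-1.
Proof. by move=> u0; rewrite -h0 h_nincr. Qed.

Lemma h_ge0 u : 0 <= u -> 0 <= h u.
Proof. by rewrite le_eqVlt => /predU1P[<-|/h_gt0/ltW//]; rewrite h0 invr_ge0. Qed.

(** Keeps the divided difference in [J] bounded as s tends to 0. One side suffices since [h]
    decreases. The endpoint 0 is handled by the expansion near 0, or by h > 0 when v > 1/2. *)
Lemma h_lip u v : 0 <= u -> u <= v -> h u - h v <= 16 * (v - u).
Proof.
rewrite le_eqVlt => /predU1P[<-|u0].
  rewrite le_eqVlt => /predU1P[<-|v0]; first by rewrite !subrr mulr0.
  rewrite h0 subr0; have [v2|v2] := leP v 2^-1.
    have /andP[+ _] := h_near0 v0 v2.
    have : v ^+ 2 <= v by rewrite expr2 ler_piMl 1?ltW//; lra.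
    lra.
  by have := h_gt0 v0; lra.
rewrite le_eqVlt => /predU1P[->|uv]; first by rewrite !subrr mulr0.
have [c c0 E] := h_MVT u0 uv.
rewrite -opprB E -mulNr; apply: ler_wpM2r; first by rewrite subr_ge0 ltW.
by have := dh_ge c0; lra.
Qed.

Lemma measurable_h : measurable_fun setT (@h R).
Proof.
apply: measurable_fun_ifT => //.
  by apply: measurable_fun_eqr.
apply: measurable_funB; apply: measurable_fun_div => //.
apply: measurable_funM => //; apply: measurable_funX.
apply: measurable_fun_div => //; apply: measurable_funB; apply: measurable_fun_expR.
  by apply: measurable_fun_div.
by apply: measurableT_comp => //; exact: measurable_fun_div.
Qed.

End KernelH.

(** * Limit criteria and integrals of indicators *)

Section Auxiliary.
Context {R : realType}.
Local Notation mu := (@lebesgue_measure R).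

Lemma cvg_at_right0_lip (f : R -> R) (A C d : R) : 0 < d ->
  (forall u : R, 0 < u -> u <= d -> `|f u - A| <= C * u) -> f x @[x --> 0^'+] --> A.
Proof.
move=> d0 fA; apply/cvgrPdist_le => e e0.
have C1 : 0 < `|C| + 1 by rewrite ltr_wpDl.
near=> x; rewrite distrC.
have x0 : 0 < x by [].
have xd : x <= d by near: x; apply: nbhs_right_le.
apply: le_trans (fA _ x0 xd) _; apply: (@le_trans _ _ ((`|C| + 1) * x)).
  by rewrite ler_wpM2r ?(ltW x0)// (le_trans (ler_norm _))// lerDl.
rewrite mulrC -ler_pdivlMr//; near: x; apply: nbhs_right_le; exact: divr_gt0.
Unshelve. all: by end_near. Qed.

Lemma cvgy_le_inv (f : R -> R) (C : R) :
  (forall u : R, 0 < u -> `|f u| <= C / u) -> f x @[x --> +oo] --> (0 : R).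
Proof.
move=> fC; apply/cvgrPdist_le => e e0; near=> x.
have x0 : 0 < x by near: x; exact: nbhs_pinfty_gt.
rewrite sub0r normrN; apply: le_trans (fC _ x0) _.
by rewrite ler_pdivrMr// mulrC -ler_pdivrMr.
Unshelve. all: by end_near. Qed.

Lemma pint_indic_itv (p q : R) : 0 <= p -> p <= q ->
  pintegrable (fun x => ((p < x)%R)%:R * ((x < q)%R)%:R) /\
  pint (fun x => ((p < x)%R)%:R * ((x < q)%R)%:R) = q - p.
Proof.
move=> p0 pq.
have E (x : R) : ((p < x)%R)%:R * ((x < q)%R)%:R = \1_(`]p, q[ : set R) x :> R.
  rewrite indicE mem_setE in_itv/=.
  by case: (p < x)%R; case: (x < q)%R; rewrite ?mulr1 ?mulr0.
have mA : measurable (`]p, q[ : set R) by exact: measurable_itv.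
have mP : measurable (`]0, +oo[ : set R) by exact: measurable_itv.
have I : (\int[mu]_(x in `]0%R, +oo[) (\1_(`]p, q[ : set R) x)%:E = (q - p)%:E)%E.
  rewrite integral_indic// setIidl; last first.
    by move=> x /=; rewrite !in_itv/= andbT => /andP[px _]; exact: le_lt_trans px.
  rewrite /= lebesgue_measure_itv/= lte_fin; case: ltP => // qp.
  by rewrite (_ : q = p) ?subrr//; apply/le_anti; rewrite pq qp.
have J : pintegrable (\1_(`]p, q[ : set R) : R -> R).
  apply/integrableP; split; first by apply/measurable_EFinP; exact: measurable_indic.
  rewrite (_ : integral _ _ _ = (q - p)%:E) ?ltry//.
  rewrite -I; apply: eq_integral => x _ /=; congr EFin.
  by rewrite ger0_norm// indicE ler0n.
have -> : (fun x => ((p < x)%R)%:R * ((x < q)%R)%:R) = (\1_(`]p, q[ : set R) : R -> R).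
  by apply/funext.
by split => //; apply: EFin_inj; rewrite EFin_pint.
Qed.

Lemma pintegrable_ltr (q : R) : 0 < q -> pintegrable (fun x : R => ((x < q)%R)%:R).
Proof.
move=> q0; have [+ _] := pint_indic_itv (lexx 0) (ltW q0).
by apply: eq_pintegrable => x x0; rewrite x0 mul1r.
Qed.

Lemma pint_ltr (q : R) : 0 < q -> pint (fun x : R => ((x < q)%R)%:R) = q.
Proof.
move=> q0; have [_] := pint_indic_itv (lexx 0) (ltW q0); rewrite subr0 => {2}<-.
by apply: eq_pint => x x0; rewrite x0 mul1r.
Qed.

Lemma pint_gt0 (f : R -> R) (p q c : R) : pintegrable f -> (forall x : R, 0 < x -> 0 <= f x) ->
  0 <= p -> p < q -> 0 < c -> (forall x : R, p < x -> x < q -> c <= f x) -> 0 < pint f.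
Proof.
move=> fi f0 p0 pq c0 cf.
have [Ii I] := pint_indic_itv p0 (ltW pq).
apply: (@lt_le_trans _ _ (pint (fun x => c * (((p < x)%R)%:R * ((x < q)%R)%:R)))).
  by rewrite pintZ// I mulr_gt0// subr_gt0.
apply: le_pint => //; first exact: pintegrableZ.
move=> x x0; have [px|px] := ltP p x; last by rewrite mul0r mulr0 f0.
by have [xq|xq] := ltP x q; rewrite ?mulr1 ?mulr0 ?f0 ?cf.
Qed.

Lemma norm_le_eps (x : R) : (forall e, 0 < e -> `|x| <= e) -> x = 0.
Proof.
move=> xe; apply/eqP; rewrite -normr_le0; apply/ler_addgt0Pl => e e0.
by rewrite addr0 xe.
Qed.

Lemma derive0_pos_const (f : R -> R) : (forall x : R, 0 < x -> is_derive x 1 f 0) ->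
  forall x y : R, 0 < x -> x <= y -> f x = f y.
Proof.
move=> df x y x0; rewrite le_eqVlt => /predU1P[->//|xy].
have cf : {within `[x, y], continuous f}.
  apply: continuous_in_subspaceT => z; rewrite inE/= in_itv/= => /andP[xz _].
  exact: is_derive_continuous (df _ (lt_le_trans x0 xz)).
have [|c _] := @MVT _ f (fun=> 0) _ _ xy _ cf.
  by move=> z; rewrite in_itv/= => /andP[xz _]; exact: df (lt_trans x0 xz).
by rewrite mul0r => /eqP; rewrite subr_eq0 => /eqP.
Qed.

End Auxiliary.

(** * The Gamma integral, its derivative and functional equation *)

Section GammaKernel.
Context {R : realType}.
Implicit Types (a t x : R).

(** The power x^(a-1), written through [expR] so that it can be differentiated both in x and in the
    exponent. *)
Let xpow a x : R := expR ((a - 1) * ln x).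

Let measurable_xpow a : measurable_fun setT (xpow a).
Proof.
by apply: measurable_fun_expR; apply: measurable_funM.
Qed.

(** The constant is the maximum of e^(-tx) (1 + x)^p, reached where 1 + x = p/t. *)
Let expRN_le t p : 0 < t -> 0 < p -> exists2 C : R, 0 < C &
  forall x : R, 0 < x -> expR (- (t * x)) <= C * expR (- (p * ln (1 + x))).
Proof.
move=> t0 p0; exists (expR (t - p - p * ln (t / p))); first exact: expR_gt0.
move=> x x0; rewrite -expRD ler_expR.
have x10 : 0 < 1 + x by rewrite addr_gt0.
have tp0 : 0 < t / p by rewrite divr_gt0.
have : ln ((1 + x) * (t / p)) <= (1 + x) * (t / p) - 1.
  set y := (1 + x) * (t / p); have y0 : 0 < y by rewrite mulr_gt0.
  by rewrite -{1}(subrKC 1 y) le_ln1Dx// ltrBrDl subrr.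
rewrite lnM ?posrE// -(ler_pM2l p0).
have -> : p * ((1 + x) * (t / p) - 1) = t + t * x - p by field; rewrite gt_eqF.
lra.
Qed.

(** Once the exponential is replaced by a multiple of (1 + x)^(-a-1), the integrand has the bounded
    primitive (x / (1 + x))^a / a, so both ends are treated at once. *)
Lemma laplaceable_xpow a : 0 < a -> laplaceable (xpow a).
Proof.
move=> a0 t t0.
have a10 : 0 < a + 1 by rewrite addr_gt0.
have [C C0 HC] := expRN_le t0 a10.
pose f x : R := xpow a x * expR (- ((a + 1) * ln (1 + x))).
have fi : pintegrable f.
  apply: (@pintegrable_bounded_primitive _ _ (fun x => a^-1 * expR (a * ln x - a * ln (1 + x))) a^-1).
  - by move=> x _; rewrite mulr_ge0 ?expR_ge0.
  - move=> x x0; rewrite /f /xpow; eapply is_derive_continuous; is_der => //.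
    by rewrite addr_gt0.
  - move=> x x0; have x1 : 0 < 1 + x by rewrite addr_gt0.
    derive_to => //.
    have -> : f x = expR (a * ln x - a * ln (1 + x)) * expR (- ln x) * expR (- ln (1 + x)).
      by rewrite /f /xpow -!expRD; congr expR; ring.
    rewrite !expRN !lnK ?posrE//.
    by field; rewrite !gt_eqF.
  - move=> x x0; rewrite normrM !gtr0_norm ?invr_gt0 ?expR_gt0//.
    apply: ler_piMr; first by rewrite invr_ge0 ltW.
    by rewrite -mulrBr expR_le1 pmulr_rle0// subr_le0 ler_ln ?posrE ?addr_gt0// lerDr.
apply: pintegrable_le (pintegrableZ C fi) _.
  by apply: measurable_funTS; apply: measurable_funM; [exact: measurable_expRM|exact: measurable_xpow].
move=> x x0; rewrite ger0_norm ?mulr_ge0 ?expR_ge0// /f mulrCA mulrC.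
by rewrite ler_wpM2l ?expR_ge0// HC.
Qed.

Let normln_le e x : 0 < e -> 0 < x -> `|ln x| <= e^-1 * (expR (e * ln x) + expR (- e * ln x)).
Proof.
move=> e0 x0; rewrite ler_pdivlMl// -[X in X * _](gtr0_norm e0) -normrM.
have [h|h] := ler0P (e * ln x).
  have := expR_ge1Dx (- e * ln x); have := expR_gt0 (e * ln x); lra.
have := expR_ge1Dx (e * ln x); have := expR_gt0 (- e * ln x); lra.
Qed.

(** The logarithm costs a factor x^e + x^(-e); with e = a/2 the resulting exponents 3a/2 and a/2 are
    still positive. *)
Lemma laplaceable_norm_ln_xpow a : 0 < a -> laplaceable (fun x => `|ln x| * xpow a x).
Proof.
move=> a0; have a20 : 0 < a / 2 by rewrite divr_gt0.
have a30 : 0 < a + a / 2 by rewrite addr_gt0.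
apply: (@laplaceable_le _ (fun x => (a / 2)^-1 * (xpow (a + a / 2) x + xpow (a / 2) x))).
- apply: measurable_funTS; apply: measurable_funM; last exact: measurable_xpow.
  by apply: measurableT_comp => //; exact: measurable_ln.
- by apply: laplaceableZ; apply: laplaceableD; exact: laplaceable_xpow.
move=> x x0; rewrite ger0_norm ?mulr_ge0 ?expR_ge0//.
apply: le_trans (ler_wpM2r (expR_ge0 _) (normln_le a20 x0)) _.
rewrite -mulrA ler_wpM2l ?invr_ge0 ?(ltW a20)// mulrDl /xpow -!expRD.
rewrite le_eqVlt; apply/orP; left; apply/eqP; congr (expR _ + expR _); by field.
Qed.

Lemma GammaE t : Gamma t = pint (fun x => expR (- (1 * x)) * xpow t x).
Proof.
apply: eq_pint => x x0; rewrite /xpow /powR gt_eqF// mulrC; congr (expR _ * _).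
by rewrite mul1r.
Qed.

Lemma laplaceable_ln_xpow a : 0 < a -> laplaceable (fun x => ln x * xpow a x).
Proof.
move=> a0; apply: laplaceable_le (laplaceable_norm_ln_xpow a0) _.
  apply: measurable_funTS; apply: measurable_funM; last exact: measurable_xpow.
  exact: measurable_ln.
by move=> x x0; rewrite normrM (gtr0_norm (expR_gt0 _)).
Qed.

Lemma laplaceable_ln : laplaceable (@ln R).
Proof.
by apply: eq_laplaceable (laplaceable_ln_xpow ltr01) => x _; rewrite /xpow subrr mul0r expR0 mulr1.
Qed.

(** For s in ]t/2, 2t[ the power x^(s-1) is dominated by x^(2t-1) when x >= 1 and by x^(t/2-1) when
    x < 1, so the sum of the two serves as a uniform majorant. *)
Lemma is_derive_Gamma t : 0 < t ->
  is_derive t 1 Gamma (laplace (fun x => ln x * xpow t x) 1).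
Proof.
move=> t0.
have -> : @Gamma R = fun t => pint (fun x => expR (- (1 * x)) * xpow t x).
  by apply/funext => s; rewrite GammaE.
have t20 : 0 < t / 2 by rewrite divr_gt0.
have t2'0 : 0 < 2 * t by rewrite mulr_gt0.
pose f (s x : R) := expR (- (1 * x)) * xpow s x.
have df (s x : R) : is_derive s 1 (f ^~ x) (expR (- (1 * x)) * (ln x * xpow s x)).
  by rewrite /f /xpow; derive_to; ring.
have tI : (`]t / 2, 2 * t[ : set R) t by rewrite /= in_itv/=; apply/andP; split; lra.
have intf (s : R) : (`]t / 2, 2 * t[ : set R) s -> pintegrable (f s).
  by rewrite /= in_itv/= => /andP[ts _]; apply: (@laplaceable_xpow s) => //; exact: lt_trans ts.
have derf (s x : R) : (`]t / 2, 2 * t[ : set R) s -> (`]0, +oo[ : set R) x ->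
    derivable (f ^~ x) s 1.
  by move=> _ _; have [] := df s x.
pose G (x : R) := expR (- (1 * x)) * (`|ln x| * xpow (t / 2) x + `|ln x| * xpow (2 * t) x).
have G0 (x : R) : 0 <= G x by rewrite mulr_ge0 ?addr_ge0 ?mulr_ge0 ?expR_ge0.
have iG : pintegrable G.
  by apply: (laplaceableD (laplaceable_norm_ln_xpow t20) (laplaceable_norm_ln_xpow t2'0)).
have pE (s x : R) : partial1of2 f s x = expR (- (1 * x)) * (ln x * xpow s x).
  by rewrite /partial1of2; exact: derive1_is_derive.
have Gub (s x : R) : (`]t / 2, 2 * t[ : set R) s -> (`]0, +oo[ : set R) x ->
    `|partial1of2 f s x| <= G x.
  rewrite /= !in_itv/= andbT => /andP[ts st] x0.
  rewrite pE normrM (gtr0_norm (expR_gt0 _)) ler_wpM2l ?expR_ge0//.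
  rewrite normrM (gtr0_norm (expR_gt0 _)) -mulrDr ler_wpM2l//.
  have [l0|l0] := leP 0 (ln x).
    apply: (@le_trans _ _ (xpow (2 * t) x)); last by rewrite lerDr expR_ge0.
    by rewrite ler_expR ler_wpM2r// lerD2r ltW.
  apply: (@le_trans _ _ (xpow (t / 2) x)); last by rewrite lerDl expR_ge0.
  by rewrite ler_expR; apply: ler_wnM2r; [exact: ltW|rewrite lerD2r ltW].
have mP : measurable (`]0, +oo[ : set R) by exact: measurable_itv.
have d := @derivable_under_integral R _ (measurableTypeR R) lebesgue_measure f `]0, +oo[ mP _ _ _ tI intf derf _ G0 iG Gub.
have e := @differentiation_under_integral R _ (measurableTypeR R) lebesgue_measure f `]0, +oo[ mP _ _ _ tI intf derf _ G0 iG Gub.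
apply: DeriveDef; first exact: d.
by rewrite -derive1E [LHS]e; apply: eq_pint => x _; rewrite pE.
Qed.

Lemma Gamma1 : Gamma 1 = 1 :> R.
Proof.
rewrite GammaE -[RHS](invr1) -laplace1//.
by apply: eq_pint => x _; rewrite /xpow subrr mul0r expR0.
Qed.

Lemma Gamma_gt0 t : 0 < t -> 0 < Gamma t.
Proof.
move=> t0; rewrite GammaE.
apply: (@pint_gt0 _ _ 1 2 (expR (- 2 - `|t - 1| * ln 2))) => //.
- exact: laplaceable_xpow.
- by move=> x _; rewrite mulr_ge0 ?expR_ge0.
- by rewrite ltr1n.
- exact: expR_gt0.
move=> x x1 x2; have x0 : 0 < x by exact: lt_trans x1.
rewrite -expRD ler_expR mul1r lerD//; first by rewrite lerN2 ltW.
have lx : 0 <= ln x by rewrite ln_ge0// ltW.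
have l2 : ln x <= ln 2 by rewrite ler_ln ?posrE// ltW.
apply: (@le_trans _ _ (- (`|t - 1| * ln x))); first by rewrite lerN2 ler_wpM2l.
by rewrite -mulNr ler_wpM2r// lerNl -normrN ler_norm.
Qed.

(** Integration by parts in one stroke: the integrand of Gamma(t+1) - t Gamma(t) is the derivative
    of -e^(-x) x^t, which vanishes at both ends. *)
Lemma GammaS t : 0 < t -> Gamma (t + 1) = t * Gamma t.
Proof.
move=> t0.
have t10 : 0 < t + 1 by rewrite addr_gt0.
have [C C0 HC] := expRN_le ltr01 t10.
have it := laplaceable_xpow t0 ltr01.
have it1 := laplaceable_xpow t10 ltr01.
apply/eqP; rewrite -subr_eq0 !GammaE -pintZ// -pintB//; last exact: pintegrableZ.
set I := pint _; suff -> : I = 0 - 0 by rewrite subrr.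
apply: (@pint_FTC _
  (fun x => expR (- (1 * x)) * xpow (t + 1) x - t * (expR (- (1 * x)) * xpow t x))
  (fun x => - (expR (- (1 * x)) * expR (t * ln x))) 0 0).
- by apply: pintegrableB => //; exact: pintegrableZ.
- by move=> x x0; rewrite /xpow; eapply is_derive_continuous; is_der.
- move=> x x0; derive_to => //.
  have -> : xpow t x = expR (t * ln x) / x by rewrite /xpow mulrBl mul1r expRB lnK.
  by rewrite /xpow addrK; field; rewrite gt_eqF.
- rewrite -[X in _ --> X]oppr0; apply: cvgN.
  apply: (@squeeze_cvgr _ _ _ _ (fun=> 0) (fun x => x `^ t)).
  + near=> x; have x0 : 0 < x by [].
    rewrite mulr_ge0 ?expR_ge0//= /powR gt_eqF// ler_piMl ?expR_ge0//.
    by rewrite expR_le1 oppr_le0 mul1r ltW.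
  + exact: cvg_cst.
  + exact: powR_cvg0.
- apply: (@cvgy_le_inv _ _ C) => x x0.
  rewrite normrN ger0_norm ?mulr_ge0 ?expR_ge0//.
  apply: le_trans (ler_wpM2r (expR_ge0 _) (HC _ x0)) _.
  rewrite -mulrA ler_pM2l// -expRD -[X in _ <= X^-1]lnK ?posrE// -expRN ler_expR.
  have : t * ln x <= t * ln (1 + x) by rewrite ler_wpM2l ?ltW// ltr_ln ?posrE ?addr_gt0// ltrDr.
  have : ln x <= ln (1 + x) by rewrite ler_ln ?posrE ?addr_gt0// lerDr.
  lra.
Unshelve. all: by end_near. Qed.

End GammaKernel.

(** * Laplace representations of digamma, [Theta] and the logarithm *)

Section Digamma.
Context {R : realType}.
Implicit Types (t u x : R).

Definition phi u : R := (1 - expR (- u))^-1 - u^-1.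

Let e1_gt0 u : 0 < u -> 0 < 1 - expR (- u).
Proof. by move=> u0; rewrite subr_gt0 expR_lt1 oppr_lt0. Qed.

Let e1_le u : 1 - expR (- u) <= u.
Proof. by have := expR_ge1Dx (- u); lra. Qed.

Lemma phi_bound u : 0 < u -> 0 <= phi u <= 1.
Proof.
move=> u0; have e0 := e1_gt0 u0; apply/andP; split.
  by rewrite subr_ge0 lef_pV2 ?posrE.
(* The upper bound amounts to (1 + u) e^(-u) <= 1. *)
have -> : phi u = 1 - (1 - (1 + u) * expR (- u)) / (u * (1 - expR (- u))).
  by rewrite /phi; field; rewrite !gt_eqF.
rewrite gerBl divr_ge0//; last by rewrite mulr_ge0// ltW.
by rewrite subr_ge0 expRN ler_pdivrMr ?expR_gt0// mul1r expR_ge1Dx.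
Qed.

Lemma is_derive_phi u : 0 < u -> is_derive u 1 phi (h u).
Proof.
move=> u0; have e0 := e1_gt0 u0; rewrite /phi.
derive_to; [by rewrite gt_eqF|by rewrite gt_eqF|].
rewrite /h gt_eqF// /sinh.
have ab := expRxMexpNx_1 (u / 2).
have e2 : expR (- u) = expR (- (u / 2)) ^+ 2 by rewrite -expRM_natl; congr expR; field.
have dgt : expR (- (u / 2)) < expR (u / 2) by rewrite ltr_expR; lra.
move: e0; rewrite e2 => e0.
move: ab dgt e0; set a := expR (u / 2); set b := expR (- (u / 2)) => ab dgt e0.
have -> : 1 - b ^+ 2 = b * (a - b) by rewrite -ab; ring.
have b0 : b != 0 by rewrite gt_eqF// expR_gt0.
have d0 : a - b != 0 by rewrite subr_eq0 gt_eqF.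
by field; rewrite d0 b0 gt_eqF.
Qed.

Lemma measurable_phi : measurable_fun setT phi.
Proof.
apply: measurable_funB; apply: measurable_funV => //.
by apply: measurable_funB => //; apply: measurable_fun_expR; exact: measurable_funN.
Qed.

Lemma laplaceable_phi : laplaceable phi.
Proof.
apply: laplaceable_le laplaceable1 _; first exact: measurable_funTS measurable_phi.
by move=> u u0; have /andP[p0 p1] := phi_bound u0; rewrite ger0_norm.
Qed.

(** phi(u) - 1/2 = n(u) / (2u (e^u - 1)) with n of third order at 0, against a denominator of at
    least 2 u^2. The order of n is found by integrating twice from 0, as for [S] and [T]. *)
Lemma phi_near0 : phi u @[u --> 0^'+] --> (2^-1 : R).
Proof.
apply: (@cvg_at_right0_lip _ _ _ 1 2^-1) => // u u0 u2.
have eu : expR u != 0 by rewrite gt_eqF ?expR_gt0.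
have e1 : u <= expR u - 1 by have := expR_ge1Dx u; lra.
have e10 : 0 < expR u - 1 by exact: lt_le_trans e1.
pose n u : R := u * (expR u + 1) - 2 * (expR u - 1).
have phiE : phi u - 2^-1 = n u / (2 * u * (expR u - 1)).
  rewrite /phi /n expRN; field; rewrite eu (gt_eqF u0) (gt_eqF e10)/=.
  by [].
pose n1 u : R := 1 + u * expR u - expR u.
have dn y : is_derive (y : R) 1 n (n1 y) by rewrite /n /n1; derive_to; ring.
have dn1 y : is_derive (y : R) 1 n1 (y * expR y) by rewrite /n1; derive_to; ring.
have n10 : n1 0 = 0 by rewrite /n1 mul0r expR0; ring.
have n0 : n 0 = 0 by rewrite /n mul0r expR0; ring.
have n1_gt0 y : 0 < y -> 0 < n1 y.
  by apply: (derive_pos_gt0 dn1) => // z z0; rewrite mulr_gt0 ?expR_gt0.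
have n_gt0 y : 0 < y -> 0 < n y by apply: (derive_pos_gt0 dn).
have n1_le y : 0 < y -> y <= 2^-1 -> 0 <= y ^+ 2 - n1 y.
  move=> y0 y2; move: y y0 y2; apply: (@derive_le_ge0 _ (fun y => y ^+ 2 - n1 y) (fun y => 2 * y - y * expR y)).
  - by move=> y; have ? := dn1 y; derive_to; ring.
  - by rewrite n10 expr0n subr0.
  move=> y y0 y2; rewrite subr_ge0 mulrC ler_pM2r//.
  rewrite -[y]opprK expRN -[leRHS]invrK lef_pV2 ?posrE ?expR_gt0//.
  by apply: le_trans (expR_ge1Dx _); lra.
have n_le y : 0 < y -> y <= 2^-1 -> 0 <= y ^+ 3 / 3 - n y.
  move=> y0 y2; move: y y0 y2; apply: (@derive_le_ge0 _ (fun y => y ^+ 3 / 3 - n y) (fun y => y ^+ 2 - n1 y)) => //.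
  - by move=> y; have ? := dn y; derive_to; field.
  - by rewrite n0 expr0n mul0r subr0.
have nu0 := n_gt0 _ u0; have := n_le _ u0 u2; rewrite subr_ge0 => nu.
rewrite phiE ger0_norm; last by rewrite divr_ge0 ?mulr_ge0 ?(ltW u0) ?(ltW nu0) ?(ltW e10).
rewrite mul1r ler_pdivrMr ?mulr_gt0//; apply: (le_trans nu).
apply: (@le_trans _ _ (u * (2 * u * u))).
  have : 0 <= u ^+ 3 by rewrite exprn_ge0// ltW.
  have -> : u * (2 * u * u) = 2 * u ^+ 3 by ring.
  lra.
by rewrite !ler_pM2l ?mulr_gt0.
Qed.

Lemma laplace_expRN_mul (w : R -> R) t : laplace (fun u => expR (- u) * w u) t = laplace w (t + 1).
Proof.
apply: eq_pint => u _; rewrite mulrA -expRD; congr (expR _ * _); ring.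
Qed.

(* Frullani's integral; both sides have the same derivative in t and tend to 0. *)
Lemma laplace_frullani t : 0 < t ->
  laplaceable (fun u => (1 - expR (- u)) / u) /\
  laplace (fun u => (1 - expR (- u)) / u) t = ln (t + 1) - ln t.
Proof.
pose q u : R := (1 - expR (- u)) / u.
have q01 u : 0 < u -> 0 <= q u <= 1.
  move=> u0; rewrite /q; apply/andP; split.
    by rewrite divr_ge0 ?(ltW u0)// ltW// e1_gt0.
  by rewrite ler_pdivrMr// mul1r e1_le.
have lq : laplaceable q.
  apply: laplaceable_le laplaceable1 _.
    apply: measurable_funTS; apply: measurable_fun_div => //.
    by apply: measurable_funB => //; apply: measurable_fun_expR; exact: measurable_funN.
  by move=> u u0; have /andP[? ?] := q01 u u0; rewrite ger0_norm.
move=> t0; split => //.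
pose E t := laplace q t - (ln (t + 1) - ln t).
have dE (s : R) : 0 < s -> is_derive s 1 E 0.
  move=> s0; have s1 : 0 < s + 1 by rewrite addr_gt0.
  have ? := is_derive_laplace s0 lq.
  rewrite /E; derive_to => //.
  suff -> : laplace (fun u => u * q u) s = s^-1 - (s + 1)^-1 by field; rewrite !gt_eqF.
  rewrite -!laplace1// -laplace_expRN_mul.
  have le : laplaceable (fun u => expR (- u) * 1).
    by move=> r r0; apply: eq_pintegrable (laplaceable1 (addr_gt0 r0 ltr01)) => u _;
       rewrite mulrA -expRD; congr (expR _ * _); ring.
  rewrite -mulN1r -laplaceZ// -laplaceD//; [|exact: laplaceable1|exact: laplaceableZ].
  by apply: eq_laplace => u u0; rewrite /q; field; rewrite gt_eqF.
have bE (s : R) : 0 < s -> `|E s| <= 2 / s.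
  move=> s0; have s1 : 0 < s + 1 by rewrite addr_gt0.
  have a1 : 0 <= laplace q s <= s^-1.
    rewrite -laplace1//; apply/andP; split.
      by apply: laplace_ge0 => u /q01/andP[].
    by apply: le_laplace => //; [exact: laplaceable1|move=> u /q01/andP[]].
  have a2 : 0 <= ln (s + 1) - ln s <= s^-1.
    rewrite -ln_div ?posrE// mulrDl divff ?gt_eqF// mul1r; apply/andP; split.
      by rewrite ln_ge0// lerDl invr_ge0 ltW.
    by rewrite le_ln1Dx// (lt_trans _ (_ : 0 < _)) ?invr_gt0// ltrN10.
  rewrite /E ler_norml mulr_natl mulr2n; move: a1 a2 => /andP[? ?] /andP[? ?]; apply/andP; split; lra.
apply/eqP; rewrite -subr_eq0 -/(E t); apply/eqP; apply: norm_le_eps => e e0.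
(* [E] is constant, so it may be evaluated at t + 2/e, where the bound 2/s is below e. *)
have te0 : 0 < t + 2 / e by rewrite addr_gt0// divr_gt0.
rewrite (derive0_pos_const dE t0 (_ : t <= t + 2 / e)); last by rewrite lerDl divr_ge0// ltW.
apply: le_trans (bE _ te0) _; rewrite ler_pdivrMr// mulrDr mulrCA divff ?gt_eqF// mulr1.
by rewrite lerDr mulr_ge0 ?ltW.
Qed.

Let D t : R := ln t - laplace phi t.

(** Multiplying by e^(-u) shifts the transform by 1, and (1 - e^(-u)) phi(u) = 1 - (1 - e^(-u))/u:
    the constant contributes 1/t and the rest is Frullani's integral. *)
Let DS t : 0 < t -> D (t + 1) = D t + t^-1.
Proof.
move=> t0; have [lq Q] := laplace_frullani t0.
have le : laplaceable (fun u => expR (- u) * phi u).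
  move=> r r0; apply: eq_pintegrable (laplaceable_phi (addr_gt0 r0 ltr01)) => u _.
  rewrite mulrA -expRD; congr (expR _ * _); ring.
suff : laplace phi t - laplace phi (t + 1) = t^-1 - (ln (t + 1) - ln t) by rewrite /D; lra.
rewrite -Q -laplace1// -laplace_expRN_mul.
transitivity (laplace (fun u => phi u + -1 * (expR (- u) * phi u)) t).
  rewrite laplaceD ?laplaceZ//; [by rewrite mulN1r|exact: laplaceable_phi|exact: laplaceableZ].
transitivity (laplace (fun u => 1 + -1 * ((1 - expR (- u)) / u)) t); last first.
  rewrite laplaceD ?laplaceZ//; [by rewrite mulN1r|exact: laplaceable1|exact: laplaceableZ].
apply: eq_laplace => u u0; rewrite /phi; field.
by rewrite (gt_eqF u0) (gt_eqF (e1_gt0 u0)).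
Qed.

Let dG t : R := laplace (fun x => ln x * expR ((t - 1) * ln x)) 1.

Let digammaE t : 0 < t -> digamma t = dG t / Gamma t.
Proof. by move=> t0; rewrite /digamma (derive1_is_derive (is_derive_Gamma t0)). Qed.

Local Opaque laplace Gamma digamma.

(** Differentiate Gamma(t+1) = t Gamma(t) in two ways and compare. *)
Lemma digammaS t : 0 < t -> digamma (t + 1) = digamma t + t^-1.
Proof.
move=> t0; have t1 : 0 < t + 1 by rewrite addr_gt0.
have d1 : is_derive t 1 (fun t => Gamma (t + 1)) (dG (t + 1)).
  have dG1 : is_derive (t + 1) 1 Gamma (dG (t + 1)) := is_derive_Gamma t1.
  have dt : is_derive t 1 (fun t : R => t + 1) 1 by derive_to; rewrite addr0.
  by rewrite -[X in is_derive _ _ _ X]mulr1; exact: (@is_derive1_comp _ Gamma (fun t => t + 1)).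
have d2 : is_derive t 1 (fun t => Gamma (t + 1)) (Gamma t + t * dG t).
  apply: (@near_eq_is_derive _ _ _ (fun t => t * Gamma t)).
    by near=> s; rewrite GammaS//; near: s; exact: lt_nbhsr.
  have ? : is_derive t 1 Gamma (dG t) := is_derive_Gamma t0.
  by derive_to; rewrite mul1r.
have := derive1_is_derive d1; rewrite (derive1_is_derive d2) !digammaE// GammaS// => <-.
by field; rewrite !gt_eqF ?Gamma_gt0.
Unshelve. all: by end_near. Qed.

Let ln_le_sub1 x : 0 < x -> ln x <= x - 1.
Proof. by move=> x0; rewrite -{1}(subrKC 1 x) le_ln1Dx// ltrBrDl subrr. Qed.

(** Integrate the tangent bounds ln t + 1 - t/x <= ln x <= ln t + x/t - 1 against x^(t-1) e^(-x).
    The moments are Gamma(t-1), Gamma(t) and Gamma(t+1), the first of which needs t > 1. *)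
Lemma digamma_bounds t : 1 < t -> ln t - (t - 1)^-1 <= digamma t <= ln t.
Proof.
move=> t1; have t0 : 0 < t by exact: lt_trans t1.
have t10 : 0 < t - 1 by rewrite subr_gt0.
have G0 := Gamma_gt0 t0.
have lt0 := laplaceable_xpow t0; have ltp := laplaceable_xpow (addr_gt0 t0 ltr01).
have ltm := laplaceable_xpow t10; have ll := laplaceable_ln_xpow t0.
have G1 : laplace (fun x => expR ((t - 1) * ln x)) 1 = Gamma t by rewrite GammaE.
have G2 : laplace (fun x => expR ((t + 1 - 1) * ln x)) 1 = t * Gamma t by rewrite -(GammaS t0) GammaE.
have G3 : (t - 1) * laplace (fun x => expR ((t - 1 - 1) * ln x)) 1 = Gamma t.
  by rewrite -[in RHS](subrK 1 t) (GammaS t10) [in RHS]GammaE.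
rewrite digammaE//; apply/andP; split; last first.
  rewrite ler_pdivrMr// /dG.
  have -> : ln t * Gamma t = t^-1 * (t * Gamma t) + (ln t - 1) * Gamma t by field; rewrite gt_eqF.
  rewrite -{1}G2 -G1 -!laplaceZ// -laplaceD//; [|exact: laplaceableZ..].
  apply: le_laplace => //; first by apply: laplaceableD; exact: laplaceableZ.
  move=> x x0; clear G1 G2 G3; have -> : expR ((t + 1 - 1) * ln x) = x * expR ((t - 1) * ln x).
    by rewrite -{2}[x]lnK ?posrE// -expRD; congr expR; ring.
  rewrite mulrA -mulrDl ler_wpM2r ?expR_ge0//.
  have := ln_le_sub1 (divr_gt0 x0 t0); rewrite ln_div ?posrE// mulrC; lra.
rewrite ler_pdivlMr// /dG.
have -> : (ln t - (t - 1)^-1) * Gamma t =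
  (ln t + 1) * Gamma t - t * laplace (fun x => expR ((t - 1 - 1) * ln x)) 1.
  by rewrite -G3; field; rewrite gt_eqF.
rewrite -G1 -mulNr -!laplaceZ// -laplaceD//; [|exact: laplaceableZ..].
apply: le_laplace => //; first by apply: laplaceableD; exact: laplaceableZ.
move=> x x0; clear G1 G2 G3; have -> : expR ((t - 1 - 1) * ln x) = x^-1 * expR ((t - 1) * ln x).
  by rewrite -{2}[x]lnK ?posrE// -expRN -expRD; congr expR; ring.
rewrite mulrA -mulrDl ler_wpM2r ?expR_ge0//.
have := ln_le_sub1 (divr_gt0 t0 x0); rewrite ln_div ?posrE//; lra.
Qed.

(* Both sides satisfy F (t + 1) = F t + 1 / t and are asymptotic to ln. *)
Theorem digamma_laplace t : 0 < t -> digamma t = ln t - laplace phi t.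
Proof.
move=> t0; rewrite -/(D t).
have per n : digamma (t + n%:R) - D (t + n%:R) = digamma t - D t.
  elim: n => [|n IH]; first by rewrite addr0.
  have tn0 : 0 < t + n%:R by rewrite ltr_wpDr.
  have -> : t + n.+1%:R = t + n%:R + 1 by rewrite -natr1 addrA.
  by rewrite (digammaS tn0) (DS tn0) opprD addrACA subrr addr0 IH.
apply/eqP; rewrite -subr_eq0; apply/eqP; apply: norm_le_eps => e e0.
(* Chosen so that n - 1 >= 2/e: then both error terms at s = t + n, namely 1/(s - 1) for digamma and
   1/s for L[phi], are at most e/2. *)
pose n := (Num.trunc (2 / e)).+2.
have ne : 2 / e <= n%:R - 1.
  have -> : n%:R - 1 = (Num.trunc (2 / e)).+1%:R :> R by rewrite /n -natr1 addrK.
  by rewrite ltW// truncnS_gt.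
have n1 : 1 < n%:R :> R by rewrite ltr1n.
rewrite -(per n); set s := t + n%:R.
have s1 : 1 < s by rewrite ltr_wpDl ?ltW.
have s0 : 0 < s by exact: lt_trans s1.
have /andP[b1 b2] := digamma_bounds s1.
have a1 : 0 <= laplace phi s <= s^-1.
  rewrite -laplace1//; apply/andP; split.
    by apply: laplace_ge0 => u /phi_bound/andP[].
  apply: le_laplace => //; [exact: laplaceable_phi|exact: laplaceable1|].
  by move=> u /phi_bound/andP[].
have ss : s^-1 <= (s - 1)^-1 by rewrite lef_pV2 ?posrE ?subr_gt0//; lra.
have se : (s - 1)^-1 <= e / 2.
  rewrite -[leRHS]invrK invf_div lef_pV2 ?posrE ?subr_gt0 ?divr_gt0//.
  by apply: le_trans ne _; rewrite lerD2r lerDr ltW.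
move: a1 => /andP[? ?].
rewrite /D ler_norml; apply/andP; split; lra.
Qed.

Local Transparent laplace Gamma digamma.

Lemma laplaceable_h : laplaceable (@h R).
Proof.
apply: laplaceable_le (laplaceable_cst 12^-1) _; first exact: measurable_funTS measurable_h.
by move=> u u0; rewrite ger0_norm ?h_ge0 ?h_le ?ltW.
Qed.

Lemma Theta_laplace t : 0 < t -> Theta t = 2^-1 + laplace h t.
Proof.
move=> t0; rewrite /Theta digamma_laplace// opprB addrC subrK.
have lphi := laplaceable_phi t0; have lh := laplaceable_h t0.
apply/eqP; rewrite -subr_eq -/(pint _) -pintZ// -pintB//; last exact: pintegrableZ.
apply/eqP; transitivity (0 - - 2^-1 : R); last by rewrite sub0r opprK.
apply: (@pint_FTC _ (fun u => t * (expR (- (t * u)) * phi u) - expR (- (t * u)) * h u)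
  (fun u => - (expR (- (t * u)) * phi u)) (- 2^-1) 0).
- by apply: pintegrableB => //; exact: pintegrableZ.
- move=> u u0; have ? := is_derive_phi u0; have ? := is_derive_h u0.
  by eapply is_derive_continuous; is_der.
- by move=> u u0; have ? := is_derive_phi u0; derive_to; ring.
- rewrite -[X in _ --> - X](mul1r 2^-1); apply: cvgN; apply: cvgM; last exact: phi_near0.
  eapply is_derive_cvg_at_right; first is_der.
  by rewrite /= mulr0 oppr0 expR0.
- apply: (@cvgy_le_inv _ _ t^-1) => u u0; have /andP[p0 p1] := phi_bound u0.
  rewrite normrN ger0_norm ?mulr_ge0 ?expR_ge0//.
  apply: (@le_trans _ _ (expR (- (t * u)) * 1)); first by rewrite ler_wpM2l ?expR_ge0.
  rewrite mulr1 expRN -invfM lef_pV2 ?posrE ?expR_gt0 ?mulr_gt0//.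
  by apply: le_trans (expR_ge1Dx _); rewrite lerDr.
Qed.

(** At t = 1 this is Gamma'(1) = psi(1), because Gamma(1) = 1; the dilation u -> tu gives the other
    t. *)
Lemma laplace_ln t : 0 < t -> laplace (@ln R) t = - (euler_gamma + ln t) / t.
Proof.
move=> t0.
have L1 : laplace (@ln R) 1 = - euler_gamma.
  rewrite /euler_gamma opprK digammaE// Gamma1 divr1 /dG.
  by apply: eq_laplace => u _; rewrite subrr mul0r expR0 mulr1.
have := pint_scale t0 (@laplaceable_ln R 1 ltr01).
rewrite -/(laplace (@ln R) 1) L1 => E.
have E2 : pint (fun x => expR (- (1 * (t * x))) * ln (t * x)) = ln t / t + laplace (@ln R) t.
  rewrite -laplace_cst// -laplaceD//; [|exact: laplaceable_cst|exact: laplaceable_ln].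
  by apply: eq_pint => u u0; rewrite mul1r lnM ?posrE.
rewrite E2 in E.
have -> : euler_gamma = - (t * (ln t / t + laplace (@ln R) t)) by rewrite -E opprK.
by field; rewrite gt_eqF.
Qed.

End Digamma.

(** * The function [J]: reflected kernel, bounds, continuity *)

Section JFunction.
Context {R : realType}.
Local Notation mu := (@lebesgue_measure R).
Implicit Types (t u s : R).

(** The integrand of [J] in the variable s = u - v, extended by 0 to s >= u so that the domain no
    longer depends on u. *)
Definition J_kernel u s : R := ((s < u)%R)%:R * ((h (u - s) - h u) / s).
Local Notation j := J_kernel.

Lemma J_kernel_bound u s : 0 < u -> 0 < s -> 0 <= j u s <= 16 * ((s < u)%R)%:R.
Proof.
move=> u0 s0; rewrite /J_kernel; have [su|su] := ltP s u; last by rewrite mul0r mulr0 lexx.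
have us0 : 0 <= u - s by rewrite subr_ge0 ltW.
have usu : u - s <= u by rewrite gerBl ltW.
rewrite mul1r mulr1; apply/andP; split.
  by rewrite divr_ge0 ?(ltW s0)// subr_ge0 h_nincr.
rewrite ler_pdivrMr//; apply: le_trans (h_lip us0 usu) _.
by rewrite opprB addrCA subrr addr0.
Qed.

Lemma measurable_J_kernel : measurable_fun setT (fun z : R * R => j z.1 z.2).
Proof.
apply: measurable_funM; first by apply: measurable_fun_ltrb; [exact: measurable_snd|exact: measurable_fst].
apply: measurable_fun_div => //.
by apply: measurable_funB; apply: measurableT_comp => //; try exact: measurable_h;
  apply: measurable_funB.
Qed.

Let measurable_j2 u : measurable_fun setT (j u).
Proof. exact: (measurableT_comp measurable_J_kernel (pair1_measurable u)). Qed.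

Lemma pintegrable_J_kernel u : 0 < u -> pintegrable (j u).
Proof.
move=> u0; apply: pintegrable_le (pintegrableZ 16 (pintegrable_ltr u0)) _.
  exact: measurable_funTS.
by move=> s s0; have /andP[? ?] := J_kernel_bound u0 s0; rewrite ger0_norm.
Qed.

(** Reflection v = u - s. The kernel lives on the open interval, and the endpoints of [0, u] are
    null, so the diagonal value -h'(u) never enters. *)
Lemma J_pint u : 0 < u -> J u = u * pint (j u).
Proof.
move=> u0; rewrite /J; congr (_ * _).
have N1 : (-1 : R) != 0 by rewrite oppr_eq0 oner_neq0.
have ij := (pintegrable_setT _).1 (pintegrable_J_kernel u0).
rewrite pint_setT (Rintegral_affine u N1 ij) normrN1 mul1r.
have E : (fun x : R => ((0 < -1 * x + u)%R)%:R * j u (-1 * x + u)) = J_integrand u \_ (`]0, u[ : set R).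
  apply/funext => v; rewrite mulN1r addrC subr_gt0 /J_kernel patchE mem_setE in_itv/=.
  have [vu|vu] := ltP v u; last by rewrite andbF mul0r.
  rewrite mul1r gtrBl; have [v0|v0] := ltP 0 v; last by rewrite mul0r.
  by rewrite mul1r subKr /J_integrand lt_eqF.
rewrite E -Rintegral_mkcond /Rintegral; congr fine.
apply: integral_itv_bndoo; apply/measurable_EFinP.
have := integrable_affine u N1 ij; rewrite E -restrict_EFin => /(measurable_int mu).
move=> /(measurable_restrictT _ (measurable_itv _)).2 /measurable_EFinP.
exact.
Qed.

Local Opaque J pint.

(** With s = uy the cut-off becomes y < 1, free of u, and the integrand is continuous in u for each
    fixed y. *)
Lemma J_pint_scaled u : 0 < u ->
  J u = u * pint (fun y => ((y < 1)%R)%:R * ((h (u * (1 - y)) - h u) / y)).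
Proof.
move=> u0; rewrite (J_pint u0).
suff <- : pint (j u) = pint (fun y => ((y < 1)%R)%:R * ((h (u * (1 - y)) - h u) / y)) by [].
rewrite (pint_scale u0 (pintegrable_J_kernel u0)) -(pintZ u (pintegrable_scale u0 (pintegrable_J_kernel u0))).
apply: eq_pint => y y0; rewrite /J_kernel gtr_pMr// mulrBr mulr1.
by field; rewrite !gt_eqF.
Qed.

Lemma J_bound u : 0 < u -> 0 <= J u <= 16 * u ^+ 2.
Proof.
move=> u0; rewrite (J_pint u0); apply/andP; split.
  by rewrite mulr_ge0 ?(ltW u0)// pint_ge0// => s s0; have /andP[] := J_kernel_bound u0 s0.
have -> : 16 * u ^+ 2 = u * (16 * u) by ring.
rewrite ler_pM2l// -{2}(pint_ltr u0) -pintZ; last exact: pintegrable_ltr.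
apply: le_pint; [exact: pintegrable_J_kernel|exact/pintegrableZ/pintegrable_ltr|].
by move=> s s0; have /andP[] := J_kernel_bound u0 s0.
Qed.

(** Continuity under the integral sign on ]u/2, 2u[ in the scaled form, with majorant 32 u 1_{y < 1}
    from the Lipschitz bound. *)
Lemma continuous_J u : 0 < u -> {for u, continuous J}.
Proof.
move=> u0.
pose k (x y : R) := ((y < 1)%R)%:R * ((h (x * (1 - y)) - h x) / y).
have k_bound (x y : R) : 0 < x -> 0 < y -> `|k x y| <= 16 * x * ((y < 1)%R)%:R.
  move=> x0 y0; rewrite /k; have [y1|y1] := ltP y 1; last by rewrite mul0r mulr0 normr0.
  have xy0 : 0 <= x * (1 - y) by rewrite mulr_ge0 ?(ltW x0)// subr_ge0 ltW.
  have xyx : x * (1 - y) <= x by rewrite ler_piMr ?(ltW x0)// gerBl ltW.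
  rewrite mul1r mulr1 ger0_norm; last by rewrite divr_ge0 ?(ltW y0)// subr_ge0 h_nincr.
  rewrite ler_pdivrMr//; apply: le_trans (h_lip xy0 xyx) _.
  by rewrite le_eqVlt; apply/orP; left; apply/eqP; ring.
have mk (x : R) : measurable_fun setT (k x).
  apply: measurable_funM; first exact: measurable_fun_ltrb.
  apply: measurable_fun_div => //; apply: measurable_funB => //.
  by apply: measurableT_comp; [exact: measurable_h|apply: measurable_funM => //; exact: measurable_funB].
have u20 : 0 < u / 2 by rewrite divr_gt0.
have I0 (x : R) : (`]u / 2, 2 * u[ : set R) x -> 0 < x.
  by rewrite /= in_itv/= => /andP[ux _]; exact: lt_trans ux.
have il : pintegrable (fun y : R => 16 * (2 * u) * ((y < 1)%R)%:R).
  by apply: pintegrableZ; exact: pintegrable_ltr.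
have kg (x y : R) : (`]u / 2, 2 * u[ : set R) x -> 0 < y -> `|k x y| <= 16 * (2 * u) * ((y < 1)%R)%:R.
  move=> xI y0; have x0 := I0 _ xI; apply: le_trans (k_bound _ _ x0 y0) _.
  rewrite ler_wpM2r// ler_wpM2l//; move: xI; rewrite /= in_itv/= => /andP[_ xu]; exact: ltW.
have ik (x : R) : (`]u / 2, 2 * u[ : set R) x -> pintegrable (k x).
  move=> xI; apply: pintegrable_le il _; first exact: measurable_funTS.
  by move=> y y0; exact: kg.
have ck (y : R) : (`]0, +oo[ : set R) y -> {in (`]u / 2, 2 * u[ : set R), continuous (k ^~ y)}.
  rewrite /= in_itv/= andbT => y0 x /[!inE] /I0 x0; rewrite /k.
  have [y1|y1] := ltP y 1; last first.
    rewrite (_ : (fun x => _) = fun=> 0); first exact: cvg_cst.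
    by apply/funext => z; rewrite mul0r.
  have xy0 : 0 < x * (1 - y) by rewrite mulr_gt0// subr_gt0.
  have dx : is_derive x 1 (fun x : R => h (x * (1 - y))) (dh (x * (1 - y)) * (1 - y)).
    have ? := is_derive_h xy0.
    have ? : is_derive x 1 (fun x : R => x * (1 - y)) (1 - y) by derive_to; ring.
    exact: (is_derive1_comp (f := h) (g := fun x => x * (1 - y))).
  have ? := is_derive_h x0.
  by eapply is_derive_continuous; is_der.
have uI : u \in (`]u / 2, 2 * u[ : set R).
  by rewrite inE /= in_itv/=; apply/andP; split; lra.
have mP : measurable (`]0, +oo[ : set R) by exact: measurable_itv.
have ci : {for u, continuous (fun x : R => pint (k x))}.
  apply: (@continuity_under_integral R _ (measurableTypeR R) mu k `]0, +oo[ mP (u / 2) (2 * u) _ _ _ il _ u uI).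
  - exact: ik.
  - by apply: aeW => y; exact: ck.
  - by move=> x xI; apply: aeW => y /=; rewrite in_itv/= andbT => y0; exact: kg.
have cuk : {for u, continuous (fun x : R => x * pint (k x))} by apply: cvgM => //; exact: cvg_id.
rewrite /prop_for /continuous_at (J_pint_scaled u0).
apply: cvg_trans cuk; apply: near_eq_cvg; near=> x.
rewrite J_pint_scaled//; near: x; exact: lt_nbhsr.
Unshelve. all: by end_near. Qed.

Lemma laplaceable_J : laplaceable (@J R).
Proof.
apply: (@laplaceable_le _ (fun u => 16 * (u ^+ 2 * 1))).
- by apply: pos_continuous_measurable => u; exact: continuous_J.
- by apply: laplaceableZ; apply: laplaceable_powid; exact: laplaceable1.
- by move=> u u0; have /andP[? ?] := J_bound u0; rewrite ger0_norm// mulr1.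
Qed.

End JFunction.

Ltac measurability := repeat (first [done | exact: measurable_fst | exact: measurable_snd
  | exact: measurable_id | apply: measurable_fun_expR | apply: measurable_fun_ln
  | apply: measurable_funV | apply: measurable_fun_ltrb | apply: measurable_funB
  | apply: measurable_funM | apply: measurable_funD | apply: measurable_funN]).

(** * The compensated integral that produces gamma + ln t + ln u *)

Section KeyIdentity.
Context {R : realType}.
Local Notation mu := (@lebesgue_measure R).
Implicit Types (t u s y p q : R).

Local Opaque J laplace Gamma digamma.

Lemma pint_inv_itv p q : 0 < p -> p <= q ->
  pintegrable (fun s => (((s < q)%R)%:R - ((s < p)%R)%:R) / s) /\
  pint (fun s => (((s < q)%R)%:R - ((s < p)%R)%:R) / s) = ln q - ln p.
Proof.
move=> p0; rewrite le_eqVlt => /predU1P[<-|pq].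
  have E : (fun s => (((s < p)%R)%:R - ((s < p)%R)%:R) / s) = fun=> 0 * 0 :> R.
    by apply/funext => s; rewrite subrr !mul0r.
  have i0 : pintegrable (fun=> 0 : R) by exact: integrable0.
  by rewrite E subrr; split; [exact: pintegrableZ|rewrite pintZ// mul0r].
have q0 : 0 < q by exact: lt_trans pq.
have E s : (((s < q)%R)%:R - ((s < p)%R)%:R) / s = ((fun x : R => x^-1) \_ (`[p, q[ : set R)) s.
  rewrite patchE mem_setE in_itv/= leNgt.
  have [sp|ps] := ltP s p; first by rewrite (lt_trans sp pq) subrr mul0r.
  by have [sq|sq] := ltP s q; rewrite subr0 ?mul1r ?mul0r.
have fi : pintegrable (fun s => (((s < q)%R)%:R - ((s < p)%R)%:R) / s).
  apply: pintegrable_le (pintegrableZ p^-1 (pintegrable_ltr q0)) _.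
    apply: measurable_funTS; apply: measurable_fun_div => //.
    by apply: measurable_funB; exact: measurable_fun_ltrb.
  move=> s s0; have [sp|ps] := ltP s p.
    by rewrite (lt_trans sp pq) subrr mul0r normr0 mulr1 invr_ge0 ltW.
  rewrite subr0; have [sq|sq] := ltP s q; last by rewrite mul0r normr0 mulr0.
  by rewrite mul1r mulr1 ger0_norm ?invr_ge0 ?(ltW s0)// lef_pV2.
split => //; apply: EFin_inj; rewrite EFin_pint//.
transitivity (\int[mu]_(x in `[p, q]) (x^-1)%:E)%E.
  rewrite -integral_itv_bndo_bndc; last first.
    apply/measurable_EFinP; apply: measurable_funV; exact: measurable_id.
  rewrite integral_mkcond [RHS]integral_mkcond; apply: eq_integral => s _.
  rewrite restrict_EFin restrict_EFin restrict_pos /=; congr EFin.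
  rewrite E; have [s0|s0] := ltP 0 s; first by rewrite mul1r.
  by rewrite mul0r patchE memNset//= in_itv/= => /andP[ps _]; have := lt_le_trans p0 ps; rewrite ltNge s0.
rewrite (continuous_FTC2 (F := @ln R))//.
- apply: continuous_in_subspaceT => x; rewrite inE/= in_itv/= => /andP[px _].
  by apply: is_derive_continuous (is_derive_inv _); rewrite gt_eqF// (lt_le_trans p0).
- split.
  + move=> x; rewrite in_itv/= => /andP[px _].
    by have [] := is_derive1_ln (lt_trans p0 px).
  + apply: cvg_at_right_filter; exact: is_derive_continuous (is_derive1_ln p0).
  + apply: cvg_at_left_filter; exact: is_derive_continuous (is_derive1_ln q0).
- move=> x; rewrite in_itv/= => /andP[px _].
  by rewrite (derive1_is_derive (is_derive1_ln (lt_trans p0 px))).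
Qed.

(** The integrand has constant sign, decided by the order of p and q; hence the integral of its
    absolute value, which Fubini will ask for, is again explicit. *)
Lemma pint_inv_diff p q : 0 < p -> 0 < q ->
  [/\ pintegrable (fun s => (((s < q)%R)%:R - ((s < p)%R)%:R) / s),
   pint (fun s => (((s < q)%R)%:R - ((s < p)%R)%:R) / s) = ln q - ln p &
   pint (fun s => `|(((s < q)%R)%:R - ((s < p)%R)%:R) / s|) = `|ln q - ln p| ].
Proof.
wlog pq : p q / p <= q => [th|].
  move=> p0 q0; have [pq|/ltW qp] := leP p q; first exact: th.
  have [i1 i2 i3] := th q p qp q0 p0.
  have E s : (((s < q)%R)%:R - ((s < p)%R)%:R) / s = - ((((s < p)%R)%:R - ((s < q)%R)%:R) / s).
    by rewrite -mulNr opprB.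
  split.
  - by apply: eq_pintegrable (pintegrableN i1) => s _; rewrite E.
  - by rewrite -[RHS]opprB -i2 -pintN//; apply: eq_pint => s _; rewrite E.
  - by rewrite distrC -i3; apply: eq_pint => s _; rewrite E normrN.
move=> p0 q0; have [i1 i2] := pint_inv_itv p0 pq; split => //.
rewrite ger0_norm; last by rewrite subr_ge0 ler_ln ?posrE.
rewrite -i2; apply: eq_pint => s s0; rewrite ger0_norm// divr_ge0 ?(ltW s0)// subr_ge0.
by have [sp|_] := ltP s p; rewrite ?(lt_le_trans sp pq).
Qed.

Lemma pint_expRM_gt t s : 0 < t -> 0 < s ->
  pintegrable (fun y => ((s < y)%R)%:R * expR (- (t * y))) /\
  pint (fun y => ((s < y)%R)%:R * expR (- (t * y))) = expR (- (t * s)) / t.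
Proof.
move=> t0 s0.
have i1 : pintegrable (fun x => expR (- (t * s)) * (expR (- (t * x)) * 1)).
  by apply: pintegrableZ; exact: laplaceable1.
have E y : ((s < y)%R)%:R * (expR (- (t * s)) * (expR (- (t * (y - s))) * 1)) =
    ((s < y)%R)%:R * expR (- (t * y)).
  by rewrite mulr1 -expRD; congr (_ * expR _); ring.
split; first by apply: eq_pintegrable (pintegrable_shift (ltW s0) i1) => y _; rewrite E.
rewrite -(laplace1 t0) -[laplace _ _]/(pint (fun x => expR (- (t * x)) * 1)).
rewrite -(pintZ _ (laplaceable1 t0)) -(pint_shift (ltW s0) i1).
by apply: eq_pint => y _; rewrite E.
Qed.

(* Insert ln y - ln u = int_0^oo (1_{s < y} - 1_{s < u}) ds / s into the
   Laplace transform of ln and exchange the integrals. *)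
Lemma pint_expRM_indic t u : 0 < t -> 0 < u ->
  pint (fun s => (expR (- (t * s)) - ((s < u)%R)%:R) / s) = - (euler_gamma + ln t + ln u).
Proof.
move=> t0 u0.
pose d y s : R := (((s < y)%R)%:R - ((s < u)%R)%:R) / s.
(* The factor t makes t e^(-ty) dy a probability measure, so integrating out y turns 1_{s < y} -
   1_{s < u} into e^(-ts) - 1_{s < u}. *)
pose F y s : R := t * expR (- (t * y)) * d y s.
have mF : measurable_fun setT (fun z : R * R => F z.1 z.2).
  by measurability.
have id y : 0 < y -> [/\ pintegrable (d y), pint (d y) = ln y - ln u & pint (fun s => `|d y s|) = `|ln y - ln u| ].
  by move=> y0; exact: pint_inv_diff.
have te y : 0 <= t * expR (- (t * y)) by rewrite mulr_ge0 ?expR_ge0// ltW.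
have lln : laplaceable (fun y => ln y + - ln u).
  by apply: laplaceableD; [exact: laplaceable_ln|exact: laplaceable_cst].
have [| | | |E _] := @pint_fubini _ F (fun y s => `|F y s|) mF.
- by [].
- move=> y y0; have [i _ _] := id _ y0.
  by apply: pintegrable_norm; exact: pintegrableZ.
- apply: eq_pintegrable (pintegrableZ t (laplaceable_norm lln t0)) => y y0.
  have [i _ ii] := id _ y0; rewrite -ii mulrA -pintZ; last exact: pintegrable_norm.
  by apply: eq_pint => s _; rewrite normrM (ger0_norm (te y)).
- move=> s s0.
  apply: (@eq_pintegrable _ (fun y => t * (expR (- (t * y)) * d y s))); first by move=> y _; rewrite /F mulrA.
  apply: pintegrableZ; apply: (@laplaceable_le _ (fun=> s^-1)) (laplaceable_cst _) _ _ t0.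
    by apply: measurable_funTS; apply: measurable_fun_div => //;
       apply: measurable_funB => //; exact: measurable_fun_ltrb.
  move=> y y0; rewrite normrM (gtr0_norm (_ : 0 < s^-1)) ?invr_gt0// ler_piMl ?invr_ge0 ?(ltW s0)//.
  by case: (s < y); case: (s < u); rewrite ?subrr ?subr0 ?sub0r ?normrN ?normr0 ?normr1.
transitivity (pint (fun y => pint (F y))).
  rewrite E; apply: eq_pint => s s0.
  have [i1 E1] := pint_expRM_gt t0 s0.
  have i2 := laplaceable1 t0.
  transitivity (pint (fun y => t / s * (((s < y)%R)%:R * expR (- (t * y))) -
      t * ((s < u)%R)%:R / s * (expR (- (t * y)) * 1))).
    rewrite pintB; [|exact: pintegrableZ..].
    have E2 : pint (fun y => expR (- (t * y)) * 1) = t^-1 := laplace1 t0.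
    rewrite (pintZ _ i1) (pintZ _ i2) E1 E2.
    by field; rewrite !gt_eqF.
  by apply: eq_pint => y _; rewrite /F /d; field; rewrite gt_eqF.
transitivity (pint (fun y => t * (expR (- (t * y)) * (ln y + - ln u)))).
  apply: eq_pint => y y0; have [i ii _] := id _ y0.
  by rewrite (pintZ _ i) ii mulrA.
rewrite pintZ; last exact: lln.
rewrite -[pint _]/(laplace (fun y => ln y + - ln u) t) (laplaceD t0 laplaceable_ln (laplaceable_cst _)).
rewrite (laplace_cst _ t0) (laplace_ln t0).
by field; rewrite gt_eqF.
Qed.

End KeyIdentity.

(** * The Laplace transform of [J] *)

Section LaplaceJ.
Context {R : realType}.
Implicit Types (t u s y p q : R).

Local Opaque J laplace Gamma digamma.

Let lh := @laplaceable_h R.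
Let luh := laplaceable_mulid lh.

Let measurable_hD d (T : measurableType d) (f : T -> R) :
  measurable_fun setT f -> measurable_fun setT (fun x => h (f x)).
Proof. by move=> mf; apply: measurableT_comp => //; exact: measurable_h. Qed.

(* First exchange: fix the distance s = u - v. *)
Let laplace_J_shift t : 0 < t ->
  laplace J t = pint (fun s => pint (fun u => expR (- (t * u)) * u * J_kernel u s)) /\
  (forall s, 0 < s -> pintegrable (fun u => expR (- (t * u)) * u * J_kernel u s)).
Proof.
move=> t0.
pose F u s : R := expR (- (t * u)) * u * J_kernel u s.
have mF : measurable_fun setT (fun z : R * R => F z.1 z.2).
  by apply: measurable_funM; [measurability|exact: measurable_J_kernel].
have Fb u s : 0 < u -> 0 < s -> `|F u s| <= expR (- (t * u)) * u * 16 * ((s < u)%R)%:R.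
  move=> u0 s0; have /andP[k0 k1] := J_kernel_bound u0 s0.
  have e0 : 0 <= expR (- (t * u)) * u by rewrite mulr_ge0 ?expR_ge0// ltW.
  rewrite ger0_norm; last exact: mulr_ge0.
  by rewrite /F -mulrA -!mulrA ler_wpM2l ?expR_ge0// ler_wpM2l// ltW.
have iFs s : 0 < s -> pintegrable (fun u => F u s).
  move=> s0; have i0 := pintegrableZ 16 (laplaceable_mulid laplaceable1 t0).
  apply: pintegrable_le i0 _.
    by apply: measurable_funTS; exact: (measurableT_comp mF (pair2_measurable s)).
  move=> u u0; apply: le_trans (Fb u s u0 s0) _.
  have e0 : 0 <= expR (- (t * u)) * u by rewrite mulr_ge0 ?expR_ge0// ltW.
  have b1 : ((s < u)%R)%:R <= 1 :> R by case: (s < u)%R.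
  have := ler_wpM2l (mulr_ge0 e0 (ler0n _ 16)) b1; rewrite mulr1 => /le_trans; apply.
  by rewrite mulr1 mulrC.
split=> //.
have [| | | |E _] := @pint_fubini _ F (fun u s => expR (- (t * u)) * u * 16 * ((s < u)%R)%:R) mF.
- exact: Fb.
- by move=> u u0; apply: pintegrableZ; exact: pintegrable_ltr.
- apply: eq_pintegrable (pintegrableZ 16 (laplaceable_mulid (laplaceable_mulid laplaceable1) t0)) => u u0.
  by rewrite (pintZ _ (pintegrable_ltr u0)) (pint_ltr u0); ring.
- exact: iFs.
rewrite -[RHS]E; apply: eq_pint => u u0.
by rewrite (pintZ _ (pintegrable_J_kernel u0)) (J_pint u0) mulrA.
Qed.

Let m t u : R := expR (- (t * u)) * (u * h u).

(** Replace u by u + s in the part containing h(u - s). In the new weight (u + s) e^(-t(u+s)) the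
    summand s cancels 1/s and gives e^(-ts) L[h](t); the summand u combines with the part containing
    h(u) into the compensated kernel. *)
Let inner_shift t s : 0 < t -> 0 < s ->
  pint (fun u => expR (- (t * u)) * u * J_kernel u s) =
  expR (- (t * s)) * laplace h t +
    pint (fun u => m t u * ((expR (- (t * s)) - ((s < u)%R)%:R) / s)).
Proof.
move=> t0 s0.
have im : pintegrable (m t) := luh t0.
have ims : pintegrable (fun u => ((s < u)%R)%:R * m t u).
  apply: pintegrable_le im _.
    by apply: measurable_funTS; measurability; exact: measurable_h.
  move=> u u0; rewrite normrM normr_nat.
  have m0 : 0 <= m t u by rewrite !mulr_ge0 ?expR_ge0 ?h_ge0 ?(ltW u0).
  by rewrite (ger0_norm m0); case: (s < u)%R; rewrite ?mul1r ?mul0r.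
pose f v : R := expR (- (t * s)) * (m t v) + s * expR (- (t * s)) * (expR (- (t * v)) * h v).
have if_ : pintegrable f.
  by apply: pintegrableD; apply: pintegrableZ => //; exact: lh.
have pf : pint f = expR (- (t * s)) * pint (m t) + s * expR (- (t * s)) * laplace h t.
  rewrite pintD; [|exact: pintegrableZ|apply: pintegrableZ; exact: lh].
  by rewrite (pintZ _ im) (pintZ _ (lh t0)).
transitivity (pint (fun u => s^-1 * (((s < u)%R)%:R * f (u - s)) - s^-1 * (((s < u)%R)%:R * m t u))).
  apply: eq_pint => u u0; rewrite /J_kernel /f /m.
  have -> : expR (- (t * (u - s))) = expR (- (t * u)) / expR (- (t * s)).
    by rewrite -expRB; congr expR; ring.
  by field; rewrite !gt_eqF ?expR_gt0.
have ifs := pintegrable_shift (ltW s0) if_.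
rewrite pintB; [|exact: pintegrableZ..].
rewrite (pintZ _ ifs) (pintZ _ ims) (pint_shift (ltW s0) if_) pf.
have -> : pint (fun u => m t u * ((expR (- (t * s)) - ((s < u)%R)%:R) / s)) =
    expR (- (t * s)) / s * pint (m t) - s^-1 * pint (fun u => ((s < u)%R)%:R * m t u).
  rewrite -(pintZ _ im) -(pintZ _ ims) -pintB; [|exact: pintegrableZ..].
  by apply: eq_pint => u u0; field; rewrite gt_eqF.
by field; rewrite gt_eqF.
Qed.

(** The compensated kernel is at most t for s < u, as 1 - e^(-ts) <= ts, and at most e^(-ts)/u for s
    >= u. The majorant [G] then has s-integral e^(-tu) (t u^2 h(u) + h(u)/t), again integrable in
    u. *)
Let outer_fubini t : 0 < t ->
  pint (fun s => pint (fun u => m t u * ((expR (- (t * s)) - ((s < u)%R)%:R) / s))) =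
  pint (fun u => m t u * - (euler_gamma + ln t + ln u)) /\
  pintegrable (fun s => pint (fun u => m t u * ((expR (- (t * s)) - ((s < u)%R)%:R) / s))).
Proof.
move=> t0.
pose F u s : R := m t u * ((expR (- (t * s)) - ((s < u)%R)%:R) / s).
pose G u s : R := expR (- (t * u)) * (u * h u) * (t * ((s < u)%R)%:R + u^-1 * (expR (- (t * s)) * 1)).
have mF : measurable_fun setT (fun z : R * R => F z.1 z.2).
  by rewrite /F /m; measurability; apply: measurable_hD; measurability.
have m0 u : 0 < u -> 0 <= m t u.
  by move=> u0; rewrite !mulr_ge0 ?expR_ge0 ?h_ge0 ?(ltW u0).
have dF u s : 0 < u -> 0 < s ->
    `|(expR (- (t * s)) - ((s < u)%R)%:R) / s| <= t * ((s < u)%R)%:R + u^-1 * (expR (- (t * s)) * 1).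
  move=> u0 s0; rewrite normrM (gtr0_norm (_ : 0 < s^-1)) ?invr_gt0// ler_pdivrMr//.
  have [su|us] := ltP s u.
    rewrite (_ : true%:R = 1)// distrC ger0_norm; last by rewrite subr_ge0 expR_le1 oppr_le0 mulr_ge0 ?(ltW t0) ?(ltW s0).
    have := expR_ge1Dx (- (t * s)); rewrite [(t * 1)%R]mulr1 mulrDl.
    set X := u^-1 * _ * s; have : 0 <= X by rewrite !mulr_ge0 ?expR_ge0 ?invr_ge0 ?(ltW u0) ?(ltW s0).
    lra.
  rewrite (_ : false%:R = 0)// subr0 (gtr0_norm (expR_gt0 _)) mulr0 add0r mulr1.
  have -> : u^-1 * expR (- (t * s)) * s = s / u * expR (- (t * s)) by ring.
  by rewrite ler_peMl ?expR_ge0// ler_pdivlMr// mul1r.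
have Fb u s : 0 < u -> 0 < s -> `|F u s| <= G u s.
  by move=> u0 s0; rewrite normrM (ger0_norm (m0 u u0)) ler_wpM2l ?m0 ?dF.
have iG u : 0 < u -> pintegrable (G u).
  move=> u0; apply/pintegrableZ/pintegrableD; apply: pintegrableZ; first exact: pintegrable_ltr.
  exact: laplaceable1.
have iFs s : 0 < s -> pintegrable (fun u => F u s).
  move=> s0; have i0 := pintegrableZ s^-1 (luh t0).
  apply: pintegrable_le i0 _.
    by apply: measurable_funTS; exact: (measurableT_comp mF (pair2_measurable s)).
  move=> u u0; rewrite normrM (ger0_norm (m0 u u0)) mulrC ler_wpM2r ?m0//.
  rewrite normrM (gtr0_norm (_ : 0 < s^-1)) ?invr_gt0// ler_piMl ?invr_ge0 ?(ltW s0)//.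
  have e1 : expR (- (t * s)) <= 1 by rewrite expR_le1 oppr_le0 mulr_ge0 ?(ltW t0) ?(ltW s0).
  have e0 := expR_gt0 (- (t * s)).
  by rewrite ler_norml; case: (s < u)%R; rewrite /= ?mulr1n ?mulr0n; apply/andP; split; lra.
have [| | | |E iE] := @pint_fubini _ F G mF.
- exact: Fb.
- exact: iG.
- have i1 : laplaceable (fun u : R => t * (u * (u * h u)) + t^-1 * h u).
    by apply: laplaceableD; apply: laplaceableZ => //; exact: laplaceable_mulid.
  apply: eq_pintegrable (i1 t t0) => u u0.
  have l1 := laplaceable1 t0.
  rewrite pintZ; last first.
    by apply: pintegrableD; apply: pintegrableZ => //; exact: pintegrable_ltr.
  rewrite pintD; [|by apply: pintegrableZ; exact: pintegrable_ltr|exact: pintegrableZ].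
  have E2 : pint (fun y => expR (- (t * y)) * 1) = t^-1 := laplace1 t0.
  rewrite (pintZ _ (pintegrable_ltr u0)) (pint_ltr u0) (pintZ _ l1) E2.
  by field; rewrite !gt_eqF.
- exact: iFs.
split; last exact: iE.
rewrite -[LHS]E; apply: eq_pint => u u0.
have id : pintegrable (fun s => (expR (- (t * s)) - ((s < u)%R)%:R) / s).
  apply: (@pintegrable_le _ (fun s => t * ((s < u)%R)%:R + u^-1 * (expR (- (t * s)) * 1))).
  - apply: measurable_funTS; apply: measurable_fun_div => //.
    by apply: measurable_funB; [exact: measurable_expRM|exact: measurable_fun_ltrb].
  - by apply: pintegrableD; apply: pintegrableZ; [exact: pintegrable_ltr|exact: laplaceable1].
  - by move=> s s0; exact: dF.
by rewrite (pintZ _ id) pint_expRM_indic.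
Qed.

Lemma laplaceable_hln : laplaceable (fun u => u * h u * (euler_gamma + ln u) : R).
Proof.
have l1 : laplaceable (fun u : R => `|euler_gamma + ln u|).
  by apply: laplaceable_norm; apply: laplaceableD; [exact: laplaceable_cst|exact: laplaceable_ln].
apply: laplaceable_le (laplaceable_mulid l1) _.
  apply: measurable_funTS; measurability; exact: measurable_h.
move=> u u0; rewrite normrM (ger0_norm (mulr_ge0 (ltW u0) (h_ge0 (ltW u0)))).
rewrite -mulrA ler_pM2l// ler_piMl//.
by apply: le_trans (h_le (ltW u0)) _; lra.
Qed.

(** The first term is the s-integral of e^(-ts) L[h](t); the other two split -(gamma + ln t + ln u).
    The last one is what the logarithmic term of [rho] cancels. *)
Theorem laplace_J t : 0 < t -> laplace J t =
  laplace h t / t - ln t * laplace (fun u => u * h u) t -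
  laplace (fun u => u * h u * (euler_gamma + ln u)) t.
Proof.
move=> t0; have [-> _] := laplace_J_shift t0.
have [E iE] := outer_fubini t0.
transitivity (pint (fun s => laplace h t * (expR (- (t * s)) * 1) +
    pint (fun u => m t u * ((expR (- (t * s)) - ((s < u)%R)%:R) / s)))).
  by apply: eq_pint => s s0; rewrite (inner_shift t0 s0) mulr1 [in RHS]mulrC.
have l1 := laplaceable1 t0.
have E2 : pint (fun y => expR (- (t * y)) * 1) = t^-1 := laplace1 t0.
rewrite pintD//; last exact: pintegrableZ.
rewrite (pintZ _ l1) E2 E -addrA; congr (_ + _).
have -> : - (ln t * laplace (fun u => u * h u) t) - laplace (fun u => u * h u * (euler_gamma + ln u)) t =
   laplace (fun u => - ln t * (u * h u) + -1 * (u * h u * (euler_gamma + ln u))) t.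
  rewrite (laplaceD t0 (laplaceableZ _ luh) (laplaceableZ _ laplaceable_hln)).
  by rewrite (laplaceZ _ t0 luh) (laplaceZ _ t0 laplaceable_hln) mulNr mulN1r.
by apply: eq_pint => u u0; rewrite /m; ring.
Qed.

End LaplaceJ.

(** * The function [rho]: transform, bounds, minimum *)

Section Rho.
Context {R : realType}.
Implicit Types (t u : R).

Local Opaque J laplace Gamma digamma.

Local Notation gamma := (@euler_gamma R).

Lemma laplaceable_rho : laplaceable (@rho R).
Proof.
apply: laplaceableD laplaceable_J.
by apply: laplaceableD laplaceable_hln; exact: laplaceable_cst.
Qed.

(** The right-hand side is the derivative of (1/2 + L[h](t)) ln t, since L[h]' = -L[uh]. *)
Lemma laplace_rho t : 0 < t -> laplace rho t =
  2^-1 / t + laplace h t / t - ln t * laplace (fun u => u * h u) t.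
Proof.
move=> t0.
have l1 := @laplaceable_cst R (1 / 2).
have l2 := laplaceableD l1 laplaceable_hln.
rewrite [LHS](laplaceD t0 l2 laplaceable_J) (laplaceD t0 l1 laplaceable_hln).
by rewrite (laplace_J t0) (laplace_cst _ t0); ring.
Qed.

Lemma continuous_rho u : 0 < u -> {for u, continuous (@rho R)}.
Proof.
move=> u0; apply: cvgD; last exact: continuous_J.
have ? := is_derive_h u0; have ? := is_derive1_ln u0.
have H : is_derive u 1 (fun u => 1 / 2 + u * h u * (gamma + ln u))
  ((1 * h u + u * dh u) * (gamma + ln u) + u * h u * u^-1).
  by derive_to => //; ring.
exact: is_derive_continuous H.
Qed.

Let b : R := expR (- gamma).

Let b_gt0 : 0 < b. Proof. exact: expR_gt0. Qed.

Let gamma_ln_ge0 u : b <= u -> 0 <= gamma + ln u.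
Proof.
move=> bu; have u0 : 0 < u by exact: lt_le_trans bu.
by rewrite -lerBlDl sub0r -(ler_expR (- gamma)) lnK ?posrE.
Qed.

Lemma rho_ge_half u : b <= u -> 1 / 2 <= rho u.
Proof.
move=> bu; have u0 : 0 < u by exact: lt_le_trans bu.
have /andP[J0 _] := J_bound u0.
rewrite /rho -addrA lerDl addr_ge0//.
by rewrite mulr_ge0 ?gamma_ln_ge0// mulr_ge0 ?h_ge0 ?(ltW u0).
Qed.

(* u (gamma + ln u) is minimal at u = exp (- gamma - 1). *)
Lemma rho_gt_alpha0 u : 0 < u -> - alpha0 < rho u.
Proof.
move=> u0; have e0 := expR_gt0 (- gamma - 1).
have [bu|ub] := leP b u.
  by have := rho_ge_half bu; rewrite /alpha0; lra.
have /andP[J0 _] := J_bound u0.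
have g0 : gamma + ln u < 0.
  by rewrite -ltrBrDl sub0r -ltr_expR lnK ?posrE.
have h1 : 12^-1 * (gamma + ln u) < h u * (gamma + ln u) by rewrite ltr_nM2r// h_lt.
have h2 : u * (12^-1 * (gamma + ln u)) < u * h u * (gamma + ln u).
  by rewrite -[ltRHS]mulrA ltr_pM2l.
(* With y = e^(gamma + ln u + 1) the product is e^(-gamma-1) y (ln y - 1), and y (ln y - 1) >=
   -1. *)
have h3 : - expR (- gamma - 1) <= u * (gamma + ln u).
  have -> : u = expR (- gamma - 1) * expR (gamma + ln u + 1).
    by rewrite -expRD -[LHS]lnK ?posrE//; congr expR; ring.
  rewrite lnM ?posrE ?expR_gt0// !expRK.
  have -> : gamma + (- gamma - 1 + (gamma + ln u + 1)) = gamma + ln u by ring.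
  rewrite -mulrA -[leLHS]mulrN1 ler_pM2l//.
  have := expR_ge1Dx (- (gamma + ln u + 1)).
  rewrite expRN; set y := expR _; have y0 : 0 < y by exact: expR_gt0.
  move=> H; have := ler_wpM2l (ltW y0) H; rewrite divff ?gt_eqF//; lra.
rewrite /rho /alpha0; lra.
Qed.

Lemma rho_lt_half : exists2 u : R, 0 < u & rho u < 1 / 2.
Proof.
(* 385 exceeds 24 times 16: near 0, h >= 1/24 makes the logarithmic term at most -16u, while J <= 16
   u^2 <= 8u once u <= 1/2. *)
pose v : R := `|gamma| + 385.
have v0 : 385 <= v by rewrite lerDr.
exists (expR (- v)); first exact: expR_gt0.
set u := expR (- v).
have u0 : 0 < u by exact: expR_gt0.
have u2 : u <= 2^-1.
  rewrite /u expRN lef_pV2 ?posrE ?expR_gt0//.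
  by apply: le_trans (expR_ge1Dx _); lra.
have /andP[_ J1] := J_bound u0.
have lu : gamma + ln u <= - 385.
  by rewrite /u expRK /v; have := ler_norm gamma; lra.
have h24 := h_ge_near0 u0 u2.
have H : h u * (gamma + ln u) <= 24^-1 * (gamma + ln u).
  by apply: ler_wnM2r => //; lra.
have H2 : u * h u * (gamma + ln u) <= u * (24^-1 * (gamma + ln u)).
  by rewrite -[leLHS]mulrA ler_pM2l.
have H3 : u * (24^-1 * (gamma + ln u)) <= u * - 16 by rewrite ler_pM2l//; lra.
have H4 : 16 * u ^+ 2 <= 8 * u.
  have -> : 16 * u ^+ 2 = 16 * u * u by ring.
  by rewrite ler_pM2r//; lra.
rewrite /rho; lra.
Qed.

(** Only the lower half of rho(0+) = 1/2 is needed, so J >= 0 is dropped. With v = sqrt u, the bound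
    ln v >= -1/v gives u ln u >= -2v, hence u (gamma + ln u) >= -v (|gamma| + 2). *)
Let rho_near0 e : 0 < e -> exists2 a : R, 0 < a &
  forall u, 0 < u -> u < a -> 1 / 2 - e <= rho u.
Proof.
move=> e0; pose c : R := `|gamma| + 2.
have c0 : 0 < c by rewrite ltr_wpDl.
pose d := Num.min 1 (e / c).
have d0 : 0 < d by rewrite lt_min ltr01 divr_gt0.
exists (d ^+ 2); first by rewrite exprn_gt0.
move=> u u0 ud; pose v := Num.sqrt u.
have v0 : 0 < v by rewrite sqrtr_gt0.
have uv : u = v ^+ 2 by rewrite sqr_sqrtr// ltW.
have vd : v < d by move: ud; rewrite uv ltr_pXn2r// nnegrE ltW.
have v1 : v < 1 by apply: lt_le_trans vd _; rewrite ge_min lexx.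
have ve : v < e / c by apply: lt_le_trans vd _; rewrite ge_min lexx orbT.
have /andP[J0 _] := J_bound u0.
have lv : - v^-1 <= ln v.
  rewrite -[v in leRHS]invrK lnV ?posrE ?invr_gt0// lerN2.
  by apply: ltW; apply: ln_sublinear; rewrite invr_gt0.
have lu : ln u = 2 * ln v by rewrite uv lnXn// mulr_natl.
have key : - e <= u * (gamma + ln u) /\ - e <= 0.
  split; last by lra.
  have : - (v * c) <= u * (gamma + ln u).
    have vg : - (v * `|gamma|) <= v ^+ 2 * gamma.
      rewrite expr2 -mulrA -mulrN ler_pM2l//.
      have := ler_norm (- gamma); rewrite normrN => g1.
      have : v * - gamma <= `|gamma|.
        apply: le_trans (ler_norm _) _; rewrite normrM (gtr0_norm v0) normrN.
        by rewrite ler_piMl// ltW.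
      by rewrite mulrN lerNl.
    have vl : - v <= v ^+ 2 * ln v.
      have -> : - v = v ^+ 2 * - v^-1 by field; rewrite gt_eqF.
      by rewrite ler_pM2l// exprn_gt0.
    rewrite lu uv /c; lra.
  apply: le_trans; rewrite lerN2 ltW//.
  by rewrite -ltr_pdivlMr.
have hu0 := h_ge0 (ltW u0); have hu1 := h_le (ltW u0).
have : - e <= u * h u * (gamma + ln u).
  rewrite mulrAC; have [X0|X0] := leP 0 (u * (gamma + ln u)).
    by apply: (le_trans key.2); rewrite mulr_ge0.
  have : u * (gamma + ln u) * 1 <= u * (gamma + ln u) * h u by rewrite ler_nM2l//; lra.
  by rewrite mulr1; apply: le_trans key.1.
rewrite /rho; lra.
Qed.

(** The extreme value theorem on a segment containing a point [u1] with rho(u1) < 1/2. To the left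
    of it [rho_near0], applied with e = 1/2 - rho(u1), gives rho >= rho(u1); to the right rho >=
    1/2. *)
Lemma rho_min : exists u0 : R, global_min_pos rho u0 /\ rho u0 < 1 / 2.
Proof.
have [u1 u10 r1] := rho_lt_half.
have e0 : 0 < 1 / 2 - rho u1 by rewrite subr_gt0.
have [a a0 Ha] := rho_near0 e0.
have au1 : Num.min a u1 <= u1 by rewrite ge_min lexx orbT.
have u1b : u1 <= b by rewrite leNgt; apply/negP => /ltW/rho_ge_half; rewrite leNgt r1.
set a' := Num.min a u1 in au1.
have a'0 : 0 < a' by rewrite lt_min a0.
have cr : {within `[a', b], continuous rho}.
  apply: continuous_in_subspaceT => x; rewrite inE/= in_itv/= => /andP[ax _].
  by apply: continuous_rho; exact: lt_le_trans ax.
have [c] := EVT_min (le_trans au1 u1b) cr.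
rewrite in_itv/= => /andP[ac cb] cmin.
have cu1 : rho c <= rho u1 by apply: cmin; rewrite in_itv/= au1.
exists c; split; last exact: le_lt_trans cu1 r1.
split; first exact: lt_le_trans ac.
move=> u u0; have [ua|au] := ltP u a'.
  have ua' : u < a by apply: lt_le_trans ua _; rewrite ge_min lexx.
  by apply: (le_trans cu1); have := Ha _ u0 ua'; rewrite opprB addrCA subrr addr0.
have [ub|bu] := leP u b; first by apply: cmin; rewrite in_itv/= au.
by apply: (le_trans cu1); apply: le_trans (ltW r1) _; apply: rho_ge_half; exact: ltW.
Qed.

(** A uniform gap far out, which makes the transforms strictly positive even at the critical
    parameter, where alpha + rho vanishes at the minimum. *)
Lemma rho_gt_far (u0 : R) : rho u0 < 1 / 2 -> exists c, [/\ 0 < c, 0 < 1 / 2 - rho u0 &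
  forall u, c < u -> 1 / 2 - rho u0 <= rho u - rho u0].
Proof.
move=> r0; exists b; split => //; first by rewrite subr_gt0.
by move=> u /ltW/rho_ge_half; lra.
Qed.

End Rho.

(** * Differentiability of every order on the half-line *)

Section Smoothness.
Context {R : realType}.
Implicit Types (f g : R -> R) (t : R) (n : nat).

Lemma eq_pos_is_derive f g t d : (forall s : R, 0 < s -> f s = g s) -> 0 < t ->
  is_derive t 1 g d -> is_derive t 1 f d.
Proof.
move=> fg t0; apply: near_eq_is_derive; near=> s; rewrite fg//.
near: s; exact: lt_nbhsr.
Unshelve. all: by end_near. Qed.

Lemma is_derive_pos_derive1 f t : derivable f t 1 -> is_derive t 1 f (f^`()%classic t).
Proof. by move=> df; rewrite derive1E; exact: derivableP. Qed.

(** Smoothness cut at order n, so that sums, products and the equation satisfied by [f_] can be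
    treated by induction on n. It depends only on the values at positive points. *)
Fixpoint pos_differentiable n f : Prop :=
  if n is n'.+1 then
    (forall t : R, 0 < t -> derivable f t 1) /\ pos_differentiable n' (f^`()%classic)
  else True.

Lemma eq_pos_differentiable n f g : (forall s : R, 0 < s -> f s = g s) ->
  pos_differentiable n g -> pos_differentiable n f.
Proof.
elim: n f g => [//|n IH] f g fg [dg ng].
have fd t (t0 : 0 < t) := eq_pos_is_derive fg t0 (is_derive_pos_derive1 (dg t t0)).
split; first by move=> t t0; have [] := fd t t0.
by apply: IH ng => t t0; exact: derive1_is_derive (fd t t0).
Qed.

Lemma pos_differentiableS n f (df : R -> R) :
  (forall t : R, 0 < t -> is_derive t 1 f (df t)) -> pos_differentiable n df ->
  pos_differentiable n.+1 f.
Proof.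
move=> fd ndf; split; first by move=> t t0; have [] := fd t t0.
by apply: eq_pos_differentiable ndf => t t0; exact: derive1_is_derive (fd t t0).
Qed.

Lemma pos_differentiableW n f : pos_differentiable n.+1 f -> pos_differentiable n f.
Proof. by elim: n f => [//|n IH] f [df nf]; split => //; exact: IH. Qed.

Lemma pos_differentiableD n f g : pos_differentiable n f -> pos_differentiable n g ->
  pos_differentiable n (fun t => f t + g t).
Proof.
elim: n f g => [//|n IH] f g [df nf] [dg ng].
apply: (pos_differentiableS _ (IH _ _ nf ng)) => t t0.
have ? := is_derive_pos_derive1 (df t t0); have ? := is_derive_pos_derive1 (dg t t0).
by is_der.
Qed.

Lemma pos_differentiableM n f g : pos_differentiable n f -> pos_differentiable n g ->
  pos_differentiable n (fun t => f t * g t).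
Proof.
elim: n f g => [//|n IH] f g nf' ng'.
have nf := pos_differentiableW nf'; have ng := pos_differentiableW ng'.
move: nf' ng' => [df nf'] [dg ng'].
apply: (pos_differentiableS _ (pos_differentiableD (IH _ _ nf' ng) (IH _ _ nf ng'))) => t t0.
have ? := is_derive_pos_derive1 (df t t0); have ? := is_derive_pos_derive1 (dg t t0).
by is_der.
Qed.

Lemma pos_differentiable_cst n (c : R) : pos_differentiable n (fun=> c).
Proof.
elim: n c => [//|n IH] c.
by apply: (pos_differentiableS _ (IH 0)) => t t0; exact: is_derive_cst.
Qed.

Lemma pos_differentiable_laplace n (w : R -> R) : laplaceable w ->
  pos_differentiable n (laplace w).
Proof.
elim: n w => [//|n IH] w lw.
have nl := pos_differentiableM (pos_differentiable_cst n (-1)) (IH _ (laplaceable_mulid lw)).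
apply: (pos_differentiableS _ nl) => t t0.
by rewrite mulN1r; exact: is_derive_laplace.
Qed.

Lemma pos_differentiable_smooth f : (forall n, pos_differentiable n f) -> smooth_pos f.
Proof.
move=> nf n; elim: n f nf => [|n IH] f nf t t0.
  by rewrite derive1n0; have [df _] := nf 1%N; exact: df.
by rewrite derive1Sn; apply: IH => // m; have [] := nf m.+1.
Qed.

End Smoothness.

(** * Logarithmic complete monotonicity: sufficiency and necessity *)

Section LogCM.
Context {R : realType}.
Implicit Types (alpha t u : R).

Local Opaque J laplace Gamma digamma.

Let w alpha u : R := alpha + rho u.

Let lw alpha : laplaceable (w alpha).
Proof. by apply: laplaceableD laplaceable_rho; exact: laplaceable_cst. Qed.

Let is_derive_g alpha t : 0 < t ->
  is_derive t 1 (fun t => - (Theta t + alpha) * ln t) (- laplace (w alpha) t).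
Proof.
move=> t0.
apply: (@eq_pos_is_derive _ _ (fun t => - (2^-1 + laplace h t + alpha) * ln t)) => //.
  by move=> s s0; rewrite Theta_laplace.
have ? := is_derive_laplace t0 (@laplaceable_h R).
derive_to => //.
rewrite (laplaceD t0 (laplaceable_cst alpha) laplaceable_rho) (laplace_rho t0) (laplace_cst _ t0).
by field; rewrite gt_eqF.
Qed.

Let ln_f alpha : @ln R \o f_ alpha = fun t => - (Theta t + alpha) * ln t.
Proof. by apply/funext => t; rewrite /= /f_ expRK. Qed.

Lemma derive1n_ln_f alpha n t : 0 < t ->
  (-1) ^+ n.+1 * (@ln R \o f_ alpha)^`(n.+1)%classic t =
  laplace (fun u => u ^+ n * (alpha + rho u)) t.
Proof.
move=> t0.
suff -> : (@ln R \o f_ alpha)^`(n.+1)%classic t =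
    (-1) ^+ n.+1 * laplace (fun u => u ^+ n * w alpha u) t.
  by rewrite mulrA -exprD addnn -mul2n exprM sqrrN expr1n expr1n mul1r.
elim: n t t0 => [|n IH] t t0.
  rewrite derive1n1 ln_f (derive1_is_derive (is_derive_g alpha t0)) expr1 mulN1r.
  by congr (- _); apply: eq_laplace => u _; rewrite expr0 mul1r.
rewrite derive1nS.
have ln := laplaceable_powid n (lw alpha).
have dl := is_derive_laplace t0 ln.
have d : is_derive t 1 (fun t => (-1) ^+ n.+1 * laplace (fun u => u ^+ n * w alpha u) t)
    ((-1) ^+ n.+2 * laplace (fun u => u ^+ n.+1 * w alpha u) t).
  derive_to; rewrite mul0r add0r mulrN -mulNr [in RHS]exprS mulN1r; congr (_ * _).
  by apply: eq_laplace => u _; rewrite mulrA -exprS.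
by rewrite (derive1_is_derive (eq_pos_is_derive IH t0 d)).
Qed.

(** Bootstrap through f' = -L[alpha + rho] f: order n for f gives order n + 1. *)
Lemma smooth_f alpha : smooth_pos (f_ alpha).
Proof.
apply: pos_differentiable_smooth; elim => [//|n IH].
have nl := pos_differentiableM (pos_differentiable_cst n (-1)) (pos_differentiable_laplace n (lw alpha)).
apply: (pos_differentiableS _ (pos_differentiableM nl IH)) => t t0.
by rewrite mulN1r; exact: is_derive_fun_expR (is_derive_g alpha t0).
Qed.

Let f_gt0 alpha t : 0 < f_ alpha t. Proof. exact: expR_gt0. Qed.

(** The integrand is nonnegative everywhere, and on ]c, c + 1[ it exceeds a positive constant by
    [rho_gt_far]. *)
Lemma strictly_lcm alpha (u0 : R) : global_min_pos rho u0 -> rho u0 < 1 / 2 ->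
  - rho u0 <= alpha -> strictly_log_completely_monotone (f_ alpha).
Proof.
move=> [u00 umin] r0 ra; split; [by move=> t _; exact: f_gt0|exact: smooth_f|].
move=> [//|n] t _ t0; rewrite derive1n_ln_f//.
have [c [c0 d0 Hc]] := rho_gt_far r0.
have w0 u : 0 < u -> 0 <= w alpha u by move=> /umin; rewrite /w; lra.
apply: (@pint_gt0 _ _ c (c + 1) (expR (- (t * (c + 1))) * (c ^+ n * (1 / 2 - rho u0)))).
- exact: (laplaceable_powid n (lw alpha)).
- by move=> u u_0; rewrite mulr_ge0 ?expR_ge0// mulr_ge0 ?w0 ?exprn_ge0// ltW.
- exact: ltW.
- by rewrite ltrDl.
- by rewrite !mulr_gt0 ?expR_gt0 ?exprn_gt0.
move=> u cu uc; have u_0 : 0 < u by exact: lt_trans cu.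
apply: ler_pM; rewrite ?expR_ge0 ?mulr_ge0 ?exprn_ge0 ?(ltW c0) ?(ltW d0)//.
  by rewrite ler_expR lerN2 ler_pM2l// ltW.
apply: ler_pM; rewrite ?exprn_ge0 ?(ltW c0) ?(ltW d0)//.
  by rewrite lerXn2r ?nnegrE ?(ltW c0) ?(ltW cu) ?(ltW u_0).
by have := Hc _ cu; lra.
Qed.

(* ln y <= 2 (sqrt y - 1) and ln y >= 1 - 1 / y *)
Let kernel_far (y d : R) : 0 < y -> 0 <= d -> d <= `|Num.sqrt y - 1| ->
  ln y + 1 - y <= - d ^+ 2.
Proof.
move=> y0 d0 dy; set v := Num.sqrt y in dy.
have v0 : 0 < v by rewrite sqrtr_gt0.
have yv : y = v ^+ 2 by rewrite sqr_sqrtr// ltW.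
have lv : ln v <= v - 1 by rewrite -{1}(subrKC 1 v) le_ln1Dx// ltrBrDl subrr.
have ly : ln y = 2 * ln v by rewrite yv lnXn// mulr_natl.
have : d ^+ 2 <= (v - 1) ^+ 2 by rewrite -[leRHS]real_normK ?num_real// lerXn2r ?nnegrE.
rewrite ly yv; lra.
Qed.

Let kernel_near (y d : R) : 2^-1 <= y -> `|y - 1| <= d -> - (2 * d ^+ 2) <= ln y + 1 - y.
Proof.
move=> y2 yd; have y0 : 0 < y by apply: lt_le_trans y2; rewrite invr_gt0.
have ly : ln y^-1 <= y^-1 - 1 by rewrite -{1}(subrKC 1 y^-1) le_ln1Dx// ltrBrDl subrr invr_gt0.
rewrite lnV ?posrE// in ly.
have d0 : 0 <= d by apply: le_trans yd.
have d2 : (y - 1) ^+ 2 <= d ^+ 2 by rewrite -[leLHS]real_normK ?num_real// lerXn2r ?nnegrE.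
have yi : y^-1 <= 2 by rewrite -[leRHS]invrK lef_pV2 ?posrE ?invr_gt0.
have yE : 1 - y^-1 + 1 - y = - ((y - 1) ^+ 2 * y^-1) by field; rewrite gt_eqF.
have : (y - 1) ^+ 2 * y^-1 <= d ^+ 2 * 2 by apply: ler_pM; rewrite ?sqr_ge0 ?invr_ge0// ltW.
lra.
Qed.

(* Laplace's method: as n -> oo the kernel u^n exp (- (1 + n / u0) u)
   concentrates at u0. *)
Lemma laplace_pow_ge0 (v : R -> R) (u0 : R) : laplaceable v -> 0 < u0 -> {for u0, continuous v} ->
  (forall n t, 0 < t -> 0 <= laplace (fun u => u ^+ n * v u) t) -> 0 <= v u0.
Proof.
move=> lv u00 cv Hv; rewrite leNgt; apply/negP => vu0.
pose e := - v u0 / 2; have e0 : 0 < e by rewrite divr_gt0 ?oppr_gt0.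
have [eta [eta0 eta2 Heta]] : exists eta : R, [/\ 0 < eta, eta <= 2^-1 &
    forall u, `|u / u0 - 1| < eta -> v u <= - e].
  have /cvgrPdist_lt/(_ e e0)/nbhs_ballP[dl /= dl0 Hd] := cv.
  exists (Num.min 2^-1 (dl / u0)); split.
  - by rewrite lt_min invr_gt0 ltr0n divr_gt0.
  - by rewrite ge_min lexx.
  move=> u; rewrite lt_min => /andP[_ ud].
  have : ball u0 dl u.
    rewrite /ball/= distrC; move: ud; rewrite -(ltr_pM2r u00) divfK ?gt_eqF//.
    by rewrite -{2}(gtr0_norm u00) -normrM mulrBl divfK ?gt_eqF// mul1r.
  by move/Hd; rewrite /= ltr_norml => /andP[h1 h2]; rewrite /e in h1 h2 *; lra.
(* With y = u/u0 and |y - 1| >= eta: if sqrt y <= 2 then sqrt y + 1 <= 3 and |sqrt y - 1| >= eta/3;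
   otherwise sqrt y - 1 > 1 > d. So the exponent per unit of n is at most -d^2 far from u0. *)
pose d := eta / 3; have d0 : 0 < d by rewrite divr_gt0.
(* The near zone loses at most 2 d'^2 = d^2/2 = x, only half of the decay d^2 gained in the far
   zone. *)
pose d' := d / 2; have d'0 : 0 < d' by rewrite divr_gt0.
pose x := d ^+ 2 / 2; have x0 : 0 < x by rewrite divr_gt0 ?exprn_gt0.
have k_far u : 0 < u -> eta <= `|u / u0 - 1| -> ln (u / u0) + 1 - u / u0 <= - d ^+ 2.
  move=> u_0 eu; set y := u / u0 in eu *; have y0 : 0 < y by rewrite divr_gt0.
  apply: kernel_far => //; first exact: ltW.
  set s := Num.sqrt y; have s0 : 0 < s by rewrite sqrtr_gt0.
  have ys : y - 1 = (s - 1) * (s + 1) by rewrite -(sqr_sqrtr (ltW y0)) -/s; ring.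
  have s10 : 0 < s + 1 by rewrite addr_gt0.
  have [s2|s2] := leP s 2.
    have : `|s - 1| * (s + 1) <= `|s - 1| * 3 by rewrite ler_wpM2l//; lra.
    by move: eu; rewrite ys normrM (gtr0_norm s10) /d; lra.
  by apply: (@le_trans _ _ (s - 1)); [rewrite /d; lra|exact: ler_norm].
have k_near u : `|u / u0 - 1| < d' -> - x <= ln (u / u0) + 1 - u / u0.
  move=> ud; have -> : - x = - (2 * d' ^+ 2) by rewrite /x /d'; field.
  apply: kernel_near; last exact: ltW.
  by move: ud; rewrite ltr_norml => /andP[]; rewrite /d' /d; lra.
pose W := laplace (fun u => `|v u|) 1.
have lnv := laplaceable_norm lv.
pose p := u0 * (1 - d'); pose q := u0 * (1 + d').
have p0 : 0 <= p by rewrite mulr_ge0 ?(ltW u00)// subr_ge0 /d' /d; lra.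
have pq : p <= q by rewrite ler_pM2l//; lra.
have [ii iE] := pint_indic_itv p0 pq.
pose K := e * expR (- (2 * u0)) * (q - p).
have qp0 : 0 < q - p by rewrite subr_gt0 /p /q ltr_pM2l//; lra.
have K0 : 0 < K by rewrite /K mulr_gt0// mulr_gt0// expR_gt0.
(* After multiplication by e^(n (1 - ln u0)) the kernel is e^(-u) e^(n (ln y + 1 - y)) with y =
   u/u0. The summand 1 in [t] leaves the factor e^(-u), which keeps the far contribution below a
   multiple of the fixed integral [W]. *)
have bound n : K * expR (n%:R * - x) <= expR (n%:R * - d ^+ 2) * W.
  pose t := 1 + n%:R / u0.
  have t0 : 0 < t by rewrite ltr_pwDl// divr_ge0// ltW.
  pose c := expR (n%:R * (1 - ln u0)).
  have := Hv n t t0; rewrite -(pmulr_rge0 _ (expR_gt0 (n%:R * (1 - ln u0)))).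
  have ln_ := laplaceable_powid n lv.
  rewrite -(laplaceZ _ t0 ln_).
  (* A majorant of the integrand: on ]p, q[, where u <= 2 u0 and v <= -e, the first term is a
     guaranteed negative amount; the second dominates the far zone. *)
  pose B u : R := - (e * expR (- (2 * u0)) * expR (n%:R * - x)) * (((p < u)%R)%:R * ((u < q)%R)%:R) +
    expR (n%:R * - d ^+ 2) * (expR (- (1 * u)) * `|v u|).
  have iB : pintegrable B.
    by apply: pintegrableD; apply: pintegrableZ => //; exact: lnv.
  have pB : pint B = - (K * expR (n%:R * - x)) + expR (n%:R * - d ^+ 2) * W.
    rewrite pintD; [|exact: pintegrableZ|apply: pintegrableZ; exact: (lnv 1 ltr01)].
    rewrite (pintZ _ ii) iE (pintZ _ (lnv 1 ltr01)); congr (_ + _).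
    by rewrite /K; ring.
  move=> Hge; rewrite -subr_ge0 addrC -pB; apply: (le_trans Hge).
  apply: le_pint => //; first exact: (laplaceableZ _ ln_ t0).
  move=> u u_0.
  have -> : expR (- (t * u)) * (expR (n%:R * (1 - ln u0)) * (u ^+ n * v u)) =
      expR (n%:R * (ln (u / u0) + 1 - u / u0)) * (expR (- (1 * u)) * v u).
    have -> : u ^+ n = expR (n%:R * ln u) by rewrite expRM_natl lnK.
    rewrite !mulrA -!expRD; congr (expR _ * _).
    by rewrite ln_div ?posrE// /t; field; rewrite gt_eqF.
  have eu := expR_gt0 (- (1 * u)).
  have en := expR_gt0 (n%:R * (ln (u / u0) + 1 - u / u0)).
  rewrite /B.
  have B2 : 0 <= expR (n%:R * - d ^+ 2) * (expR (- (1 * u)) * `|v u|).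
    by rewrite !mulr_ge0 ?expR_ge0.
  have in_pq : (p < u) && (u < q) = (`|u / u0 - 1| < d').
    have uE : u = u0 * (u / u0) by field; rewrite gt_eqF.
    rewrite [in LHS]uE !ltr_pM2l// ltr_norml.
    by apply/andP/andP => -[? ?]; split; lra.
  have [un|uf] := boolP (`|u / u0 - 1| < d').
    move: (in_pq); rewrite un => /andP[-> ->]; rewrite /= !mulr1n !mulr1.
    have ue : v u <= - e by apply: Heta; apply: lt_trans un _; rewrite /d' /d; lra.
    apply: (@le_trans _ _ (- (e * expR (- (2 * u0)) * expR (n%:R * - x)))); last by rewrite lerDl.
    have v0 : 0 <= e by exact: ltW.
    have u2 : u <= 2 * u0.
      move: (in_pq); rewrite un => /andP[_ uq]; apply: (le_trans (ltW uq)).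
      by rewrite /q mulrC ler_pM2r// /d' /d; lra.
    have e1 : expR (n%:R * - x) <= expR (n%:R * (ln (u / u0) + 1 - u / u0)).
      by rewrite ler_expR ler_wpM2l// k_near.
    have e2 : expR (- (2 * u0)) <= expR (- (1 * u)) by rewrite ler_expR lerN2 mul1r.
    have e3 : e <= - v u by rewrite lerNr.
    have e12 := ler_pM (expR_ge0 _) (expR_ge0 _) e1 e2.
    have := ler_pM (mulr_ge0 (expR_ge0 _) (expR_ge0 _)) v0 e12 e3.
    lra.
  have -> : ((p < u)%R)%:R * ((u < q)%R)%:R = 0 :> R.
    by rewrite -natrM mulnb in_pq (negbTE uf).
  rewrite mulr0 add0r.
  (* In the intermediate zone d' <= |y - 1| < eta the integrand is simply nonpositive, as v <= -e
     there. *)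
  have [ue|ue] := ltP `|u / u0 - 1| eta.
    apply: le_trans B2; rewrite pmulr_rle0// pmulr_rle0//.
    by apply: (le_trans (Heta _ ue)); rewrite oppr_le0 ltW.
  apply: (@le_trans _ _ (expR (n%:R * (ln (u / u0) + 1 - u / u0)) * (expR (- (1 * u)) * `|v u|))).
    by rewrite ler_pM2l// ler_pM2l// ler_norm.
  rewrite ler_wpM2r ?mulr_ge0 ?expR_ge0// ler_expR ler_wpM2l//.
  exact: k_far.
have W0 : 0 <= W by apply: laplace_ge0.
(* [bound] amounts to K e^(nx) <= W, and e^(nx) >= nx, so any n with K n x > W gives the
   contradiction. *)
pose n := (Num.trunc (W / (K * x))).+1.
have nW : W / (K * x) < n%:R by exact: truncnS_gt.
have {}nW : W < K * (n%:R * x).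
  by move: nW; rewrite (ltr_pdivrMr _ _ (mulr_gt0 K0 x0)) (mulrCA n%:R K x).
have := bound n; have -> : n%:R * - d ^+ 2 = n%:R * - x + - (n%:R * x) by rewrite /x; field.
rewrite expRD -mulrA [leLHS]mulrC ler_pM2l ?expR_gt0// expRN mulrC ler_pdivlMr ?expR_gt0//.
apply/negP; rewrite -ltNge; apply: (@lt_le_trans _ _ (K * (n%:R * x))).
  exact: nW.
by rewrite ler_pM2l//; apply: le_trans (expR_ge1Dx _); rewrite lerDr.
Qed.

Lemma lcm_ge alpha (u0 : R) : 0 < u0 -> log_completely_monotone (f_ alpha) -> - rho u0 <= alpha.
Proof.
move=> u00 [_ _ Hm]; rewrite -subr_ge0 opprK.
apply: (@laplace_pow_ge0 (w alpha)) => //.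
  by apply: cvgD; [exact: cvg_cst|exact: continuous_rho].
by move=> n t t0; rewrite -derive1n_ln_f//; exact: Hm.
Qed.

End LogCM.

Theorem proposition5p3 (R : realType) :
  exists u0 : R, global_min_pos rho u0 /\
    let alpha_star := - rho u0 in
    [/\ - (1 / 2) < alpha_star,
        alpha_star < alpha0,
        forall alpha : R,
          log_completely_monotone (f_ alpha) <-> alpha_star <= alpha &
        forall alpha : R,
          alpha_star <= alpha -> strictly_log_completely_monotone (f_ alpha)].
Proof.
have [u0 [umin r0]] := @rho_min R.
have strict := fun alpha => @strictly_lcm R alpha u0 umin r0.
exists u0; split => //=; split => //.
- by rewrite ltrN2.
- by have := rho_gt_alpha0 umin.1; lra.
move=> alpha; split; first exact: lcm_ge umin.1.
move=> /strict[f0 fs fm]; split => // m t m1 t0; exact/ltW/fm.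
Qed.
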